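(* The following explicit description holds for the generators of the groups $\mathrm{Aut}(\Phi)$ of automorphisms of the root systems of the classical groups $O_{2\ell+1}$, $Sp_{2\ell}$, $O_{2\ell}$ and of the corresponding Weyl groups, in terms of the simple reflections $s_i^{A_{n-1}}=(i\;i+1)\in W(\Phi(A_{n-1}))=\mathfrak S_n$. (B) For $G=O_{2\ell+1}$ one has $\mathrm{Aut}(\Phi(B_\ell))=W(\Phi(B_\ell))$, and the simple root generators $s_i^{B_\ell}\in W(\Phi(B_\ell))$ can be expressed in terms of $s_i^{A_{2\ell}}\in W(\Phi(A_{2\ell}))$ as $$s_1^{B_\ell}=s_\ell^{A_{2\ell}}s_{\ell+1}^{A_{2\ell}}s_\ell^{A_{2\ell}}=s_{\ell+1}^{A_{2\ell}}s_\ell^{A_{2\ell}}s_{\ell+1}^{A_{2\ell}},\qquad s_k^{B_\ell}=s_{\ell+1-k}^{A_{2\ell}}s_{\ell+k}^{A_{2\ell}}=s_{\ell+k}^{A_{2\ell}}s_{\ell+1-k}^{A_{2\ell}},\quad 1<k\le\ell.$$ (C) For $G=Sp_{2\ell}$ one has $\mathrm{Aut}(\Phi(C_\ell))=W(\Phi(C_\ell))$, and the simple root generators $s_i^{C_\ell}\in W(\Phi(C_\ell))$ can be expressed in terms of $s_i^{A_{2\ell-1}}\in W(\Phi(A_{2\ell-1}))$ as $$s_1^{C_\ell}=s_\ell^{A_{2\ell-1}},\qquad s_k^{C_\ell}=s_{\ell+1-k}^{A_{2\ell-1}}s_{\ell-1+k}^{A_{2\ell-1}}=s_{\ell-1+k}^{A_{2\ell-1}}s_{\ell+1-k}^{A_{2\ell-1}},\quad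 1<k\le\ell.$$ (D) For $G=O_{2\ell}$ one has $\mathrm{Aut}(\Phi(D_\ell))=W(\Phi(D_\ell))\rtimes\mathrm{Out}(\Phi(D_\ell))$, and the simple root generators $s_i^{D_\ell}\in W(\Phi(D_\ell))$ together with the generator $R\in\mathrm{Out}(\Phi(D_\ell))=\mathbb Z/2\mathbb Z$ can be expressed in terms of $s_i^{A_{2\ell-1}}\in W(\Phi(A_{2\ell-1}))$ as $$s_1^{D_\ell}=s_\ell^{A_{2\ell-1}}s_{\ell-1}^{A_{2\ell-1}}s_{\ell+1}^{A_{2\ell-1}}s_\ell^{A_{2\ell-1}}=s_\ell^{A_{2\ell-1}}s_{\ell+1}^{A_{2\ell-1}}s_{\ell-1}^{A_{2\ell-1}}s_\ell^{A_{2\ell-1}},$$ $$s_k^{D_\ell}=s_{\ell+1-k}^{A_{2\ell-1}}s_{\ell-1+k}^{A_{2\ell-1}}=s_{\ell-1+k}^{A_{2\ell-1}}s_{\ell+1-k}^{A_{2\ell-1}},\quad 1<k\le\ell;\qquad R=s_\ell^{A_{2\ell-1}}.$$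
   Context: $\mathrm{Aut}(\Phi)$ is the group of all automorphisms of the root system $\Phi$ (linear automorphisms of its span preserving $\Phi$), $W(\Phi)$ is its Weyl group, and $\mathrm{Out}(\Phi)$ is the group of symmetries of its Dynkin diagram. Here $\ell\ge1$ in types $B_\ell$, $C_\ell$ and $\ell\ge2$ in type $D_\ell$. Realizations. Let $\epsilon_1,\dots,\epsilon_n$ be the standard basis of $\mathbb R^n$, permuted by $\mathfrak S_n=W(\Phi(A_{n-1}))$. Type $B_\ell$: $n=2\ell+1$, $\epsilon_k^{B}=\epsilon_{\ell+1-k}-\epsilon_{\ell+1+k}$ for $1\le k\le\ell$; $\Phi(B_\ell)=\{\pm\epsilon_i^B\pm\epsilon_j^B\ (i<j),\ \pm\epsilon_i^B\}$; simple roots $\alpha_1=\epsilon_1^B$, $\alpha_k=\epsilon_k^B-\epsilon_{k-1}^B$ for $1<k\le\ell$. Type $C_\ell$: $n=2\ell$, $\epsilon_k^{C}=\epsilon_{\ell+1-k}-\epsilon_{\ell+k}$; $\Phi(C_\ell)=\{\pm\epsilon_i^C\pm\epsilon_j^C\ (i<j),\ \pm2\epsilon_i^C\}$; simple roots $\alpha_1=2\epsilon_1^C$, $\alpha_k=\epsilon_k^C-\epsilon_{k-1}^C$ for $1<k\le\ell$. Type $D_\ell$: $n=2\ell$, $\epsilon_k^{D}=\epsilon_{\ell+1-k}-\epsilon_{\ell+k}$; $\Phi(D_\ell)=\{\pm\epsilon_i^D\pm\epsilon_j^D\ (i<j)\}$; simple roots $\alpha_1=\epsilon_1^D+\epsilon_2^D$,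 $\alpha_k=\epsilon_k^D-\epsilon_{k-1}^D$ for $1<k\le\ell$. $s_k^{B_\ell},s_k^{C_\ell},s_k^{D_\ell}$ denote the reflections in the simple roots $\alpha_k$, acting on the span of the vectors $\epsilon_k^{B}$, $\epsilon_k^{C}$, $\epsilon_k^{D}$ respectively. $R$ is the diagram symmetry exchanging $\alpha_1$ and $\alpha_2$ and fixing the other simple roots. The displayed equalities mean that the given element of $\mathfrak S_n$, acting on $\mathbb R^n$, preserves this span and restricts on it to the given automorphism; in this way the Weyl group in question is isomorphic to a subgroup of $W(\Phi(A_{n-1}))$.
   Formalization: In (D), the claim that Out(Φ(D_ℓ)) = Z/2Z, generated by R, is stated only for ℓ ≠ 4, since the Dynkin diagram of D_4 has symmetry group S_3; all other claims, including Aut = W ⋊ Out and R = s_ℓ, are stated for every ℓ ≥ 2. *)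

(* Defs.v *)
From HB Require Import structures.
From mathcomp Require Import all_boot all_order all_algebra all_fingroup.

Set Implicit Arguments.
Unset Strict Implicit.
Unset Printing Implicit Defensive.

Import GRing.Theory Num.Theory.
Local Open Scope ring_scope.

(* Groups of linear automorphisms of a vector space over an arbitrary field
   are represented by predicates on its endomorphisms. *)
Section LinearGroups.
Variables (F : fieldType) (vT : vectType F).
Implicit Types (A N S : 'End(vT) -> Prop) (f g : 'End(vT)).

Definition lin_group A : Prop :=
  [/\ A \1%VF,
      forall f g, A f -> A g -> A (f \o g)%VF
    & forall f, A f -> lker f == 0%VS /\ A (f^-1)%VF].

Inductive lin_generated S : 'End(vT) -> Prop :=
  | lin_generated_id : lin_generated S \1%VF
  | lin_generated_in f : S f -> lin_generated S f
  | lin_generated_comp f g :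
      lin_generated S f -> lin_generated S g -> lin_generated S (f \o g)%VF
  | lin_generated_inv f : lin_generated S f -> lin_generated S (f^-1)%VF.

Definition lin_normal N A : Prop :=
  (forall f, N f -> A f) /\
  (forall f g, A f -> N g -> N (f \o g \o f^-1)%VF).

(* In a product s * t of permutations the factor s is applied first, whereas
   in f \o g it is g. *)
Definition lin_embedding n (G : {group 'S_n}) (phi : 'S_n -> 'End(vT)) : Prop :=
  {in G &, injective phi} /\
  {in G &, forall s t, phi (s * t)%g = (phi t \o phi s)%VF}.

(* A is the internal semidirect product of N and of the copy phi(G) of G. *)
Definition lin_sdprod A N n (G : {group 'S_n}) (phi : 'S_n -> 'End(vT)) : Prop :=
  [/\ lin_group A /\ lin_group N,
      lin_normal N A,
      lin_embedding G phi /\ {in G, forall s, A (phi s)},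
      {in G, forall s, N (phi s) -> phi s = \1%VF}
    & forall f, A f ->
        exists g s, [/\ N g, s \in G & f = (g \o phi s)%VF]].

End LinearGroups.

Section RootSystems.
Variables (R : realFieldType) (n : nat).
Implicit Types (a b : 'rV[R]_n) (Phi : seq 'rV[R]_n).

Definition dot a b : R := \sum_i a 0 i * b 0 i.

Definition cartan a b : R := 2 * dot a b / dot b b.

Section Span.
Variable Phi : seq 'rV[R]_n.
Let V := subvs_of <<Phi>>%VS.

Definition root_aut (f : 'End(V)) : Prop :=
  lker f == 0%VS /\ forall v : V, (vsval (f v) \in Phi) = (vsval v \in Phi).

Definition reflection_fun a (v : V) : V :=
  v - cartan (vsval v) a *: vsproj <<Phi>>%VS a.

Definition reflection a : 'End(V) := linfun (reflection_fun a).

Definition weyl : 'End(V) -> Prop :=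
  lin_generated (fun f => exists2 a, a \in Phi & f = reflection a).

(* s permutes the standard basis (e_i is sent to e_(s i)), the resulting
   automorphism of R^n preserves the span of Phi and restricts to f there. *)
Definition perm_restricts (s : 'S_n) (f : 'End(V)) : Prop :=
  forall v : V, vsval v *m perm_mx s = vsval (f v).

(* Restriction to the span of Phi is an isomorphism from H onto A. *)
Definition restriction_isom (H : {group 'S_n}) (A : 'End(V) -> Prop) : Prop :=
  exists rho : 'S_n -> 'End(V),
    [/\ {in H, forall s, perm_restricts s (rho s)},
        lin_embedding H rho
      & forall f, A f <-> exists2 s, s \in H & f = rho s].

Fact reflection_fun_linear a : linear (reflection_fun a).
Proof.
move=> k u v; rewrite /reflection_fun /cartan.
have -> : dot (vsval (k *: u + v)) a = k * dot (vsval u) a + dot (vsval v) a.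
  rewrite /dot mulr_sumr -big_split /=; apply: eq_bigr => i _.
  by rewrite !mxE mulrDl mulrA.
rewrite mulrDr mulrDl scalerDl opprD addrACA scalerBr scalerA.
by rewrite (mulrCA 2 k) -!mulrA.
Qed.

HB.instance Definition _ a :=
  GRing.isLinear.Build R V V _ (reflection_fun a) (@reflection_fun_linear a).

Lemma reflectionE a v : a \in <<Phi>>%VS ->
  vsval (reflection a v) = vsval v - (2 * dot (vsval v) a / dot a a) *: a.
Proof. by move=> Va; rewrite lfunE /= vsprojK. Qed.

End Span.

Lemma delta_perm_mx (i : 'I_n) (s : 'S_n) :
  delta_mx 0 i *m perm_mx s = delta_mx 0 (s i) :> 'rV[R]_n.
Proof.
apply/rowP=> j; rewrite mxE (bigD1 i) //= big1 => [|k ki].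
  by rewrite !mxE !eqxx mul1r addr0 eq_sym.
by rewrite !mxE (negbTE ki) andbF mul0r.
Qed.

End RootSystems.

Arguments root_aut {R n} Phi f.
Arguments weyl {R n} Phi _.

Section DynkinDiagram.
Variables (R : realFieldType) (n l : nat) (alpha : 'I_l -> 'rV[R]_n).

(* The Dynkin diagram is encoded by its Cartan matrix: the numbers of edges
   and the directions of the arrows are read off from the Cartan integers. *)
Definition diagram_sym : {set 'S_l} :=
  [set s : 'S_l | [forall i, forall j,
     cartan (alpha (s i)) (alpha (s j)) == cartan (alpha i) (alpha j)]].

Fact diagram_sym_group_set : group_set diagram_sym.
Proof.
apply/group_setP; split=> [|s t].
  by rewrite inE; apply/forallP=> i; apply/forallP=> j; rewrite !perm1.
rewrite !inE => /forallP Ps /forallP Pt.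
apply/forallP=> i; apply/forallP=> j; rewrite !permM.
by have /forallP/(_ (s j))/eqP-> := Pt (s i); have /forallP/(_ j) := Ps i.
Qed.

Canonical diagram_sym_group := group diagram_sym_group_set.

(* The linear automorphism of the span given by a diagram symmetry. *)
Definition diagram_extends (Phi : seq 'rV[R]_n) (s : 'S_l)
    (f : 'End(subvs_of <<Phi>>%VS)) : Prop :=
  forall i, f (vsproj _ (alpha i)) = vsproj _ (alpha (s i)).

End DynkinDiagram.

(* Indices of basis vectors, simple roots and simple reflections are natural
   numbers starting from 1, whereas the elements of 'I_n start from 0. *)

(* The transposition (i i+1), for 0 < i < n. *)
Definition sA (n i : nat) : 'S_n :=
  match insub i.-1 : option 'I_n, insub i : option 'I_n with
  | Some a, Some b => tperm a b
  | _, _ => 1%g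
  end.

Section ClassicalTypes.
Variables (R : realFieldType) (l : nat).

Definition eps n (i : nat) : 'rV[R]_n := \row_(j < n) (j.+1 == i)%:R.

Definition signs : seq R := [:: 1; -1].

(* All vectors +-e_i +-e_j with 1 <= i < j <= l. *)
Definition signed_pairs n (e : nat -> 'rV[R]_n) : seq 'rV[R]_n :=
  [seq c.1 *: e ij.1 + c.2 *: e ij.2 |
     ij <- [seq p <- [seq (i, j) | i <- iota 1 l, j <- iota 1 l]
              | (p.1 < p.2)%N],
     c <- [seq (a, b) | a <- signs, b <- signs]].

Definition epsB k : 'rV[R]_(2 * l + 1) := eps _ (l + 1 - k) - eps _ (l + 1 + k).
Definition epsC k : 'rV[R]_(2 * l) := eps _ (l + 1 - k) - eps _ (l + k).
Definition epsD k : 'rV[R]_(2 * l) := eps _ (l + 1 - k) - eps _ (l + k).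

Definition PhiB : seq 'rV[R]_(2 * l + 1) :=
  signed_pairs epsB ++ [seq a *: epsB i | i <- iota 1 l, a <- signs].
Definition PhiC : seq 'rV[R]_(2 * l) :=
  signed_pairs epsC ++ [seq a *: (2 *: epsC i) | i <- iota 1 l, a <- signs].
Definition PhiD : seq 'rV[R]_(2 * l) := signed_pairs epsD.

Definition alphaB k := if k == 1%N then epsB 1 else epsB k - epsB k.-1.
Definition alphaC k := if k == 1%N then 2 *: epsC 1 else epsC k - epsC k.-1.
Definition alphaD k := if k == 1%N then epsD 1 + epsD 2 else epsD k - epsD k.-1.

(* The symmetries of the diagram of type D, as permutations of 'I_l; the simple
   root alpha_k corresponds to k.-1 : 'I_l. *)
Definition OutD : {group 'S_l} :=
  diagram_sym_group (fun i : 'I_l => alphaD i.+1).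

End ClassicalTypes.

Definition swap12 l (lt1l : (1 < l)%N) : 'S_l :=
  tperm (Ordinal (ltnW lt1l)) (Ordinal lt1l).

Section Words.
Variable l : nat.
Local Open Scope group_scope.

Definition wordB k : 'S_(2 * l + 1) :=
  let s := sA (2 * l + 1) in
  if k == 1%N then s l * s (l + 1)%N * s l
  else s (l + 1 - k)%N * s (l + k)%N.

Definition wordC k : 'S_(2 * l) :=
  let s := sA (2 * l) in
  if k == 1%N then s l else s (l + 1 - k)%N * s (l - 1 + k)%N.

Definition wordD k : 'S_(2 * l) :=
  let s := sA (2 * l) in
  if k == 1%N then s l * s (l - 1)%N * s (l + 1)%N * s l
  else s (l + 1 - k)%N * s (l - 1 + k)%N.

End Words.

(* Main.v *)
(* Call the number of positive roots that an automorphism f of the root system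
   sends to negative ones its defect. If the defect is positive, some simple
   root a is sent to a negative root, and composing f with the reflection in a
   lowers the defect by 1; if it is 0, f permutes the simple roots, and it
   preserves their Cartan integers because these are read off from which
   combinations of two simple roots are roots. Hence f is a product of a Weyl
   group element and a diagram symmetry. By the exchange condition a product of
   simple reflections preserving the positive roots is the identity, so this
   product is semidirect. In types B and C the diagram has no symmetry.

   On the span of the vectors e_k the reversal of the coordinates acts as -1.
   For such vectors a transposition exchanged with itself by the reversal, or a
   product of two transpositions exchanged by it, acts as a reflection. *)

Require Import Defs.
From HB Require Import structures.
From mathcomp Require Import all_boot all_order all_algebra all_fingroup.
From mathcomp Require Import cyclic.
From mathcomp Require Import zify ring lra.

Set Implicit Arguments.
Unset Strict Implicit.
Unset Printing Implicit Defensive.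

Import Order.TTheory GRing.Theory Num.Theory.
Local Open Scope ring_scope.

(** * The dot product *)

Section Dot.
Variables (R : realFieldType) (n : nat).
Implicit Types a b c : 'rV[R]_n.

(** The three types share one argument, split by how much it has to know. [root_base] lists what the
    general theory uses, in a form checkable by direct computation: positivity is the sign of an
    integral height, and facts such as the linear independence of the simple roots are derived from
    heights and obtuse angles. The classical layer knows only pairwise orthogonal vectors [e 1],
    ..., [e l] of squared length 2 and the chain of simple roots [e k - e k.-1]; the types differ in
    the first simple root and in the multiples of [e i] that are roots. The realization enters last,
    with [e k] a difference of two coordinates exchanged by reversal and [n] equal to [2l] or
    [2l + 1]. The semidirect product is obtained with the full group of diagram symmetries, D_4
    included; only the identification of that group with Z/2 excludes [l = 4], where three outer
    nodes are interchangeable. *)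

Lemma dotC a b : dot a b = dot b a.
Proof. by apply: eq_bigr => i _; rewrite mulrC. Qed.

Lemma dotDl a b c : dot (a + b) c = dot a c + dot b c.
Proof. by rewrite -big_split; apply: eq_bigr => i _; rewrite mxE mulrDl. Qed.

Lemma dotZl k a b : dot (k *: a) b = k * dot a b.
Proof. by rewrite /dot mulr_sumr; apply: eq_bigr => i _; rewrite mxE mulrA. Qed.

Lemma dotNl a b : dot (- a) b = - dot a b.
Proof. by rewrite -scaleN1r dotZl mulN1r. Qed.

Lemma dotBl a b c : dot (a - b) c = dot a c - dot b c.
Proof. by rewrite dotDl dotNl. Qed.

Lemma dotDr a b c : dot a (b + c) = dot a b + dot a c.
Proof. by rewrite dotC dotDl !(dotC a). Qed.

Lemma dotZr k a b : dot a (k *: b) = k * dot a b.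
Proof. by rewrite dotC dotZl (dotC a). Qed.

Lemma dotNr a b : dot a (- b) = - dot a b.
Proof. by rewrite dotC dotNl (dotC a). Qed.

Lemma dotBr a b c : dot a (b - c) = dot a b - dot a c.
Proof. by rewrite dotDr dotNr. Qed.

Lemma dot0l b : dot 0 b = 0.
Proof. by rewrite -(scale0r 0) dotZl mul0r. Qed.

Lemma dot_suml I (r : seq I) (P : pred I) (F : I -> 'rV[R]_n) b :
  dot (\sum_(i <- r | P i) F i) b = \sum_(i <- r | P i) dot (F i) b.
Proof.
by elim/big_rec2: _ => [|i u v _ <-]; rewrite ?dot0l // dotDl.
Qed.

Lemma dot_ge0 a : 0 <= dot a a.
Proof. by apply: sumr_ge0 => i _; rewrite -expr2 sqr_ge0. Qed.

Lemma dot_eq0 a : (dot a a == 0) = (a == 0).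
Proof.
rewrite psumr_eq0 => [|i _]; last by rewrite -expr2 sqr_ge0.
apply/allP/eqP => [a0|-> i _]; last by rewrite mxE mul0r eqxx.
apply/rowP=> i; apply/eqP; have := a0 i (mem_index_enum i).
by rewrite mulf_eq0 orbb mxE.
Qed.

Lemma dot_gt0 a : a != 0 -> 0 < dot a a.
Proof. by move=> a0; rewrite lt_def dot_eq0 a0 dot_ge0. Qed.

Lemma cartanBl a b c : cartan (a - b) c = cartan a c - cartan b c.
Proof. by rewrite /cartan dotBl mulrBr mulrBl. Qed.

Lemma cartanDl a b c : cartan (a + b) c = cartan a c + cartan b c.
Proof. by rewrite /cartan dotDl mulrDr mulrDl. Qed.

Lemma cartanNl a b : cartan (- a) b = - cartan a b.
Proof. by rewrite /cartan dotNl mulrN mulNr. Qed.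

Lemma cartanZl k a b : cartan (k *: a) b = k * cartan a b.
Proof. by rewrite /cartan dotZl mulrCA !mulrA. Qed.

End Dot.

(** * Root systems with a base of simple roots *)

(* The height of a vector is its product with [rho], so that the simple roots
   are the roots of height 1. *)
Record root_base (R : realFieldType) n l (Phi : seq 'rV[R]_n)
    (alpha : 'I_l -> 'rV[R]_n) (rho : 'rV[R]_n) : Prop := RootBase {
  rb_simple : forall i, alpha i \in Phi;
  rb_height_simple : forall i, dot (alpha i) rho = 1;
  rb_height : forall b, b \in Phi ->
    exists m : nat, dot b rho = m.+1%:R \/ dot b rho = - m.+1%:R;
  rb_height1 : forall b, b \in Phi -> dot b rho = 1 -> exists i, b = alpha i;
  rb_opp : forall b, b \in Phi -> - b \in Phi;
  rb_refl : forall i b, b \in Phi ->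
    b - cartan b (alpha i) *: alpha i \in Phi;
  rb_cartan_le2 : forall i b, b \in Phi -> cartan b (alpha i) <= 2;
  rb_obtuse : forall i j, i != j -> dot (alpha i) (alpha j) <= 0;
  rb_descent : forall b, b \in Phi -> 1 < dot b rho ->
    exists i, 0 < dot b (alpha i) }.

Section RootBase.
Variables (R : realFieldType) (n l : nat) (Phi : seq 'rV[R]_n).
Variables (alpha : 'I_l -> 'rV[R]_n) (rho : 'rV[R]_n).
Hypothesis base : root_base Phi alpha rho.

Local Notation V := (subvs_of <<Phi>>%VS).
Implicit Types (u v b : V) (f g w : 'End(V)) (i j : 'I_l).

Local Notation a i := (vsproj <<Phi>>%VS (alpha i)).
Local Notation r i := (reflection Phi (alpha i)).
Definition form u v := dot (vsval u) (vsval v).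
Definition height v := dot (vsval v) rho.
Definition is_root v := vsval v \in Phi.
Definition is_pos v := is_root v && (0 < height v).
Definition isometry f := forall u v, form (f u) (f v) = form u v.
Definition refl_word (s : seq 'I_l) : 'End(V) :=
  foldr (fun i f => (r i \o f)%VF) \1%VF s.
Definition simple_weyl := lin_generated (fun f => exists i, f = r i).

(** * Heights, positive roots and simple reflections *)

Lemma root_vsprojK (x : 'rV_n) : x \in Phi -> vsval (vsproj <<Phi>>%VS x) = x.
Proof. by move=> /memv_span; apply: vsprojK. Qed.

Lemma vsval_simple i : vsval (a i) = alpha i.
Proof. exact: root_vsprojK (rb_simple base i). Qed.

Lemma root_simple i : is_root (a i).
Proof. by rewrite /is_root vsval_simple (rb_simple base). Qed.

Lemma height_simple i : height (a i) = 1.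
Proof. by rewrite /height vsval_simple (rb_height_simple base). Qed.

Lemma pos_simple i : is_pos (a i).
Proof. by rewrite /is_pos root_simple height_simple ltr01. Qed.

Lemma heightD u v : height (u + v) = height u + height v.
Proof. by rewrite /height linearD dotDl. Qed.

Lemma heightN u : height (- u) = - height u.
Proof. by rewrite /height linearN dotNl. Qed.

Lemma heightZ k u : height (k *: u) = k * height u.
Proof. by rewrite /height linearZ dotZl. Qed.

Lemma rootN b : is_root b -> is_root (- b).
Proof. by rewrite /is_root linearN; apply: (rb_opp base). Qed.

Lemma pos_ge1 b : is_pos b -> 1 <= height b.
Proof.
case/andP=> /(rb_height base)[m]; rewrite /height => -[]->.
  by rewrite ler1n.
by rewrite oppr_gt0 ltrn0.
Qed.

Lemma neg_root b : is_root b -> ~~ is_pos b -> is_pos (- b).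
Proof.
move=> rb; rewrite /is_pos rb rootN //= heightN.
have [m] := rb_height base rb; rewrite /height => -[]->.
  by rewrite ltr0n.
by rewrite opprK ltr0n.
Qed.

Lemma simple_norm_gt0 i : 0 < dot (alpha i) (alpha i).
Proof.
apply: dot_gt0; apply/eqP => a0; have := rb_height_simple base i.
by rewrite a0 dot0l => /esym/eqP; rewrite oner_eq0.
Qed.

Lemma cartan_simple i : cartan (alpha i) (alpha i) = 2.
Proof. by rewrite /cartan mulfK // gt_eqF // simple_norm_gt0. Qed.

Lemma alpha_inj : injective alpha.
Proof.
move=> i j eq_ij; apply/eqP; apply: contraT => /(rb_obtuse base).
by rewrite eq_ij leNgt simple_norm_gt0.
Qed.

Lemma vsproj_simple_inj : injective (fun i => a i).
Proof. by move=> i j /(congr1 vsval); rewrite !vsval_simple => /alpha_inj. Qed.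

Lemma simple_reflE i v : r i v = v - cartan (vsval v) (alpha i) *: a i.
Proof. by rewrite lfunE. Qed.

Lemma simple_refl_simple i : r i (a i) = - a i.
Proof.
rewrite simple_reflE vsval_simple cartan_simple scaler_nat mulr2n.
by rewrite opprD addNKr.
Qed.

Lemma vsval_simple_refl i v :
  vsval (r i v) = vsval v - cartan (vsval v) (alpha i) *: alpha i.
Proof. by rewrite simple_reflE linearB linearZ /= vsval_simple scalerN. Qed.

Lemma simple_reflK i : involutive (r i).
Proof.
move=> v; rewrite [LHS]simple_reflE !simple_reflE.
rewrite linearB linearZ /= vsval_simple
  cartanBl cartanZl cartan_simple scalerN -addrA -opprD -scalerDl.
set c := cartan _ _; have -> : c + (c - c * 2) = 0 by ring.
by rewrite scale0r subr0.
Qed.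

Lemma simple_refl_isometry i : isometry (r i).
Proof.
move=> u v; rewrite /form !vsval_simple_refl /cartan.
rewrite !(dotDl, dotDr, dotZl, dotZr, dotNl, dotNr) (dotC (alpha i) (vsval v)).
by field; rewrite gt_eqF // simple_norm_gt0.
Qed.

Lemma simple_refl_invol i : (r i \o r i)%VF = \1%VF.
Proof. by apply/lfunP=> v; rewrite comp_lfunE simple_reflK id_lfunE. Qed.

Lemma root_simple_refl i b : is_root b -> is_root (r i b).
Proof. by rewrite /is_root vsval_simple_refl; apply: (rb_refl base). Qed.

Lemma root_simple_reflE i b : is_root (r i b) = is_root b.
Proof. by apply/idP/idP => /(root_simple_refl i) //; rewrite simple_reflK. Qed.

Lemma height_simple_refl i b :
  height (r i b) = height b - cartan (vsval b) (alpha i).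
Proof. by rewrite simple_reflE heightD heightN heightZ height_simple mulr1. Qed.

(** If the image were negative, its height would be at most -1, so [height b + 1] would be at most
    the Cartan integer, hence at most 2. Then [b] has height 1 and is a simple root other than
    [a i], whose Cartan integer is at most 0: a contradiction. *)
Lemma pos_simple_refl i b : is_pos b -> b != a i -> is_pos (r i b).
Proof.
move=> pb nba; have [rb b_gt0] := andP pb.
apply: contraNT nba => /(neg_root (root_simple_refl i rb)) /pos_ge1.
rewrite heightN height_simple_refl => b_le.
have c_le2 : cartan (vsval b) (alpha i) <= 2 by apply: (rb_cartan_le2 base).
have b1 : height b = 1.
  have [m] := rb_height base rb; rewrite -/(height b) => -[] e; last first.
    by move: b_gt0; rewrite e oppr_gt0 ltrn0.
  case: m e => // m e; have : 2%:R <= height b by rewrite e ler_nat.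
  by lra.
have [j bj] := rb_height1 base rb b1; apply/eqP/subvs_inj.
rewrite vsval_simple bj.
have [->//|/(rb_obtuse base) ji] := eqVneq j i.
have : cartan (vsval b) (alpha i) <= 0.
  by rewrite bj /cartan pmulr_lle0 ?pmulr_rle0 // invr_gt0 simple_norm_gt0.
by move=> c_le0; exfalso; lra.
Qed.

Lemma pos_split b : is_pos b ->
  (exists i, b = a i) \/
  (exists i, [/\ is_pos (r i b), 0 < cartan (vsval b) (alpha i)
    & height (r i b) < height b]).
Proof.
move=> pb; have [rb b_gt0] := andP pb.
have [b1|b1] := eqVneq (height b) 1.
  left; have [i bi] := rb_height1 base rb b1.
  by exists i; apply: subvs_inj; rewrite vsval_simple.
right; have [|i ab] := rb_descent base rb.
  by rewrite lt_def b1 pos_ge1.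
have c_gt0 : 0 < cartan (vsval b) (alpha i).
  by rewrite /cartan divr_gt0 ?simple_norm_gt0 // mulr_gt0.
exists i; split=> //; last by rewrite height_simple_refl gtrBl.
apply: pos_simple_refl => //.
by apply: contraNneq b1 => ->; rewrite height_simple.
Qed.

(** Heights live in an ordered field, but those of roots are integers, so the strict descent of
    [pos_split] stops; the induction runs on a natural bound [m] of the height. *)
Lemma pos_ind (P : V -> Prop) : (forall i, P (a i)) ->
  (forall i b, is_pos b -> is_pos (r i b) -> 0 < cartan (vsval b) (alpha i) ->
     P (r i b) -> P b) ->
  forall b, is_pos b -> P b.
Proof.
move=> Pa Pr b pb.
have [m htb] : exists m : nat, height b < m%:R.
  have [m] := rb_height base (andP pb).1; rewrite -/(height b) => -[]->.
    by exists m.+2; rewrite ltr_nat.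
  by exists 0; rewrite oppr_lt0 ltr0n.
elim: m b pb htb => [|m IHm] b pb htb; have [rb b_gt0] := andP pb.
  by move: (lt_trans b_gt0 htb); rewrite ltxx.
have [[i ->] //|[i [pr c_gt0 lt_r]]] := pos_split pb.
apply: (Pr i) => //; apply: IHm => //.
have [[k]] := (rb_height base rb, rb_height base (andP pr).1).
rewrite -/(height b) => -[] hb; last by move: b_gt0; rewrite hb oppr_gt0 ltrn0.
case=> k'; rewrite -/(height (r i b)) => -[] hr.
  by move: htb lt_r; rewrite hb hr !ltr_nat; lia.
by move: (andP pr).2; rewrite hr oppr_gt0 ltrn0.
Qed.

(** * Words in the simple reflections *)

Lemma word_cons i s : refl_word (i :: s) = (r i \o refl_word s)%VF.
Proof. by []. Qed.

Lemma word1 i : refl_word [:: i] = r i.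
Proof. exact: comp_lfun1r. Qed.

Lemma word_cat s t : refl_word (s ++ t) = (refl_word s \o refl_word t)%VF.
Proof.
elim: s => [|i s IHs]; first by rewrite comp_lfun1l.
by rewrite cat_cons !word_cons IHs comp_lfunA.
Qed.

Lemma word_isometry s : isometry (refl_word s).
Proof.
elim: s => [|i s IHs] u v; first by rewrite !id_lfunE.
by rewrite word_cons !comp_lfunE simple_refl_isometry.
Qed.

Lemma cartan_word s u v :
  cartan (vsval (refl_word s u)) (vsval (refl_word s v)) =
  cartan (vsval u) (vsval v).
Proof. by rewrite /cartan -!/(form _ _) !word_isometry. Qed.

Lemma word_rev s : (refl_word (rev s) \o refl_word s)%VF = \1%VF.
Proof.
elim: s => [|i s IHs]; first by rewrite comp_lfun1l.
rewrite rev_cons -cats1 word_cat word1 word_cons.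
by rewrite -comp_lfunA (comp_lfunA (r i)) simple_refl_invol comp_lfun1l.
Qed.

Lemma word_revK s : cancel (refl_word s) (refl_word (rev s)).
Proof. by move=> v; rewrite -comp_lfunE word_rev id_lfunE. Qed.

Lemma word_revVK s : cancel (refl_word (rev s)) (refl_word s).
Proof. by move=> v; rewrite -{1}[s]revK word_revK. Qed.

Lemma word_inj s : lker (refl_word s) == 0%VS.
Proof. by apply/lker0P; apply: can_inj (word_revK s). Qed.

Lemma word_inv s : ((refl_word s)^-1)%VF = refl_word (rev s).
Proof.
by rewrite -[LHS]comp_lfun1l -(word_rev s) -comp_lfunA lker0_compfV
  ?comp_lfun1r ?word_inj.
Qed.

Lemma root_word s b : is_root (refl_word s b) = is_root b.
Proof.
elim: s => [|i s IHs]; first by rewrite id_lfunE.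
by rewrite word_cons comp_lfunE root_simple_reflE.
Qed.

Lemma simple_weyl_word f : simple_weyl f <-> exists s, f = refl_word s.
Proof.
split=> [|[s ->]].
  elim=> {f} [|f [i ->]|f g _ [s ->] _ [t ->]|f _ [s ->]].
  - by exists [::].
  - by exists [:: i]; rewrite word1.
  - by exists (s ++ t); rewrite word_cat.
  - by exists (rev s); rewrite word_inv.
elim: s => [|i s IHs]; first exact: lin_generated_id.
by apply: lin_generated_comp => //; apply: lin_generated_in; exists i.
Qed.

Lemma pos_word b : is_pos b -> exists s i, b = refl_word s (a i).
Proof.
move: b; apply: pos_ind => [i|i b _ _ _ [s [j rb]]].
  by exists [::], i; rewrite id_lfunE.
by exists (i :: s), j; rewrite word_cons comp_lfunE -rb simple_reflK.
Qed.

Lemma root_wordE b : is_root b -> exists s i, b = refl_word s (a i).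
Proof.
move=> rb; have [/pos_word //|] := boolP (is_pos b).
case/(neg_root rb)/pos_word=> s [i nb]; exists (rcons s i), i.
rewrite -cats1 word_cat comp_lfunE word1 simple_refl_simple linearN /= -nb.
by rewrite opprK.
Qed.

(** Words preserve the form, so conjugating a reflection by a word just moves its root. *)
Lemma reflection_conj s i : (refl_word s \o r i \o refl_word (rev s))%VF =
  reflection Phi (vsval (refl_word s (a i))).
Proof.
apply/lfunP=> v; rewrite !comp_lfunE [RHS]lfunE /= /reflection_fun vsvalK.
rewrite simple_reflE linearB linearZ /=.
rewrite -[in cartan _ _](vsval_simple i) -(cartan_word s).
by rewrite word_revVK.
Qed.

(** Every root is the image of a simple one under a word, so its reflection is a conjugate of a
    simple reflection and again a word. *)
Lemma weyl_simple f : weyl Phi f <-> simple_weyl f.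
Proof.
split; elim=> {f} [|f|f g _ Wf _ Wg|f _ Wf]; try exact: lin_generated_id;
  try exact: lin_generated_comp; try exact: lin_generated_inv.
  case=> b rb ->; apply/simple_weyl_word.
  have [|s [i bE]] := root_wordE (b := vsproj _ b).
    by rewrite /is_root root_vsprojK.
  exists (s ++ i :: rev s); rewrite word_cat word_cons comp_lfunA.
  by rewrite reflection_conj -bE root_vsprojK.
case=> i ->; apply: lin_generated_in; exists (alpha i) => //.
exact: rb_simple base i.
Qed.

Lemma weyl_word f : weyl Phi f <-> exists s, f = refl_word s.
Proof. by rewrite weyl_simple simple_weyl_word. Qed.

(** Read from the right, the word makes [a i] negative at some letter [j]. A simple reflection makes
    only its own root negative, so the part to the right of [j] maps [a i] to [a j] and conjugates
    [r i] to [r j]; the two copies of [r j] cancel and the letter disappears. *)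
Lemma exchange s i : ~~ is_pos (refl_word s (a i)) ->
  exists2 s', (size s').+1 = size s & (refl_word s \o r i)%VF = refl_word s'.
Proof.
elim: s => [|j s IHs]; first by rewrite id_lfunE pos_simple.
rewrite word_cons comp_lfunE => neg_ji.
have [pos_i|/IHs[s' szs' ws']] := boolP (is_pos (refl_word s (a i)));
  last first.
  by exists (j :: s'); rewrite /= ?szs' // -comp_lfunA ws'.
exists s => //; have := reflection_conj s i.
have /eqP-> : refl_word s (a i) == a j.
  by apply: contraNT neg_ji => ne; apply: pos_simple_refl.
rewrite vsval_simple => conj; rewrite -comp_lfunA.
have -> : (refl_word s \o r i = r j \o refl_word s)%VF.
  by rewrite -conj -!comp_lfunA word_rev comp_lfun1r.
by rewrite comp_lfunA simple_refl_invol comp_lfun1l.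
Qed.

(** Induction on the length: if [rcons s i] keeps all simple roots positive, then [s] makes [a i]
    negative, and the exchange condition gives an equal word with two letters fewer. *)
Lemma pos_word_id s : (forall i, is_pos (refl_word s (a i))) ->
  refl_word s = \1%VF.
Proof.
have [m] := ubnP (size s); elim: m => // m IHm in s *.
case/lastP: s => // s i; rewrite size_rcons ltnS => lt_sm pos_s.
have [|s' szs'] := @exchange s i.
  apply/negP=> /andP[_ ht_i]; have /andP[_] := pos_s i.
  rewrite -cats1 word_cat word1 comp_lfunE simple_refl_simple linearN heightN.
  by rewrite oppr_gt0 ltNge ltW.
rewrite -[in X in X -> _]word1 -word_cat cats1 => ws'; rewrite ws'.
by apply: IHm => [|j]; [rewrite (leq_trans _ lt_sm) // -szs' | rewrite -ws'].
Qed.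

(** This plays the role of the fact that the simple roots span: by descent through simple
    reflections, agreement passes to the positive roots, by sign to all roots, by linearity to the
    span. The target is arbitrary so that maps into the ambient space can be compared as well. *)
Lemma eq_on_simple (W : lmodType R) (f g : {linear V -> W}) :
  (forall i, f (a i) = g (a i)) -> f =1 g.
Proof.
move=> eq_fg.
have eq_pos : forall b, is_pos b -> f b = g b.
  apply: pos_ind => // i b _ _ _; rewrite simple_reflE !linearB !linearZ /=.
  by rewrite eq_fg => /addIr.
have eq_root b : is_root b -> f b = g b.
  move=> rb; have [/eq_pos//|/(neg_root rb)/eq_pos] := boolP (is_pos b).
  by rewrite !linearN => /oppr_inj.
move=> v; rewrite -[v]vsvalK (coord_span (X := in_tuple Phi) (subvsP v)).
rewrite !linear_sum; apply: eq_bigr => i _; rewrite !linearZ eq_root //.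
by rewrite /is_root root_vsprojK mem_nth.
Qed.

Lemma lfun_eq_on_simple f g : (forall i, f (a i) = g (a i)) -> f = g.
Proof. by move=> eq_fg; apply/lfunP; apply: eq_on_simple. Qed.

(* A vanishing combination gives [u = u'] where [u] and [u'] gather the
   positive and the opposite of the negative terms, and [dot u u' <= 0]. *)
Lemma simple_relation_le0 (k : 'I_l -> R) :
  \sum_i k i *: alpha i = 0 -> forall i, k i <= 0.
Proof.
rewrite (bigID (fun i => 0 < k i)) /=.
set u := \sum_(i | 0 < k i) _; set u' := \sum_(i | _) _ => uu'.
have u0 : u = 0.
  have uE : u = - u' by apply/eqP; rewrite -addr_eq0 uu'.
  apply/eqP; rewrite -dot_eq0 eq_le dot_ge0 andbT [X in dot _ X]uE dotNr.
  rewrite oppr_le0 dot_suml; apply: sumr_ge0 => i ki; rewrite dotZl dotC.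
  apply: mulr_ge0 (ltW ki) _; rewrite dot_suml; apply: sumr_ge0 => j.
  rewrite -leNgt dotZl => kj; apply: mulr_le0 => //; apply: (rb_obtuse base).
  by apply: contraTneq ki => <-; rewrite -leNgt.
have ku0 : \sum_(i | 0 < k i) k i = 0.
  rewrite -[RHS](dot0l rho) -u0 dot_suml; apply: eq_bigr => i _.
  by rewrite dotZl (rb_height_simple base) mulr1.
move=> i; rewrite leNgt; apply/negP=> ki; move/eqP: ku0; rewrite gt_eqF //.
rewrite (bigD1 i) //= ltr_wpDr //.
by apply: sumr_ge0 => j /andP[/ltW].
Qed.

Lemma free_simple : free [tuple a i | i < l].
Proof.
apply/freeP=> k; under eq_bigr do rewrite -tnth_nth tnth_mktuple.
move/(congr1 vsval); rewrite linear_sum linear0.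
under eq_bigr do rewrite linearZ /= vsval_simple.
move=> k0 i; apply/eqP; rewrite eq_le (simple_relation_le0 k0) -oppr_le0.
apply: (simple_relation_le0 (k := fun i => - k i)).
by under eq_bigr do rewrite scaleNr; rewrite sumrN k0 oppr0.
Qed.

Lemma simple_extension (t : 'S_l) : {f : 'End(V) | forall i, f (a i) = a (t i)}.
Proof.
have [f fP] := linear_of_free [tuple a i | i < l] [tuple a (t i) | i < l].
exists (linfun f) => i; rewrite lfunE.
have := fP free_simple; rewrite !size_tuple => /(_ erefl) fE.
have := congr1 (fun x => nth 0 x i) fE.
by rewrite (nth_map 0) ?size_tuple // -!tnth_nth !tnth_mktuple.
Qed.

(* Writing [x] for minus the Cartan integer of the pair [j], [i] and [x'] for
   that of its image, [alpha (t j) + x *: alpha (t i)] is a root, hence so is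
   its reflection [alpha (t j) - (x - x') *: alpha (t i)]; this has mixed signs
   when [x' < x]. *)
Lemma cartan_perm_le (g : 'End(V)) (t : 'S_l) i j :
    (forall b, is_root b -> is_root (g b)) ->
    (forall h, g (a h) = a (t h)) -> i != j ->
  cartan (alpha (t j)) (alpha (t i)) <= cartan (alpha j) (alpha i).
Proof.
move=> root_g gE ne_ij; rewrite leNgt; apply/negP.
set c := cartan _ _; set c' := cartan _ _ => lt_cc'.
have ne_tij : t i != t j by rewrite (inj_eq perm_inj).
have c'_le0 : c' <= 0.
  rewrite /c' /cartan pmulr_lle0 ?invr_gt0 ?simple_norm_gt0 // pmulr_rle0 //.
  by apply: (rb_obtuse base); rewrite eq_sym.
have c_ge : -2 <= c.
  rewrite -[c]opprK lerN2 -cartanNl; apply: (rb_cartan_le2 base).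
  exact: (rb_opp base) (rb_simple base j).
pose b : 'rV_n := alpha (t j) - (c' - c) *: alpha (t i).
have rb : b \in Phi.
  have := root_g _ (root_simple_refl i (root_simple j)).
  move=> /(root_simple_refl (t i)).
  rewrite [r i _]simple_reflE vsval_simple linearB linearZ /= !gE -/c.
  rewrite /is_root vsval_simple_refl !linearB !linearZ /=.
  rewrite !vsval_simple.
  rewrite cartanDl scalerN cartanNl cartanZl cartan_simple -/c' => rb.
  suff -> : b = alpha (t j) - c *: alpha (t i) +
      (c' - c * 2) *: - alpha (t i) by [].
  by rewrite /b scalerN -addrA -opprD -scalerDl; congr (_ - _ *: _); ring.
have hb : dot b rho = 1 - (c' - c).
  by rewrite dotBl dotZl !(rb_height_simple base) mulr1.
(* The height of [b] is a nonzero integer and [0 < c' - c <= 2], which leaves only height -1. So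
   [- b] is a simple root; its product with [alpha (t i)] is positive, hence it equals
   [alpha (t i)], and this forces [alpha (t j) = alpha (t i)]. *)
have cc2 : c' - c = 2.
  have [m] := rb_height base rb; rewrite hb => -[] hm.
    by have : 1 <= m.+1%:R :> R by [rewrite ler1n]; lra.
  case: m hm => [|m] hm; first lra.
  by have : 2 <= m.+2%:R :> R by [rewrite ler_nat]; lra.
have [|h bh] := rb_height1 base (rb_opp base rb).
  by rewrite dotNl hb cc2; ring.
have := simple_norm_gt0 (t i).
have : 0 < dot (alpha h) (alpha (t i)).
  rewrite -bh /b cc2 dotNl dotBl dotZl.
  have := simple_norm_gt0 (t i); have := rb_obtuse base ne_tij.
  by rewrite (dotC (alpha (t i)) (alpha (t j))); lra.
have [hi _ _|/(rb_obtuse base)] := eqVneq h (t i); last first.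
  by rewrite leNgt => /negP.
case/eqP: ne_tij; apply: alpha_inj; apply/esym/eqP.
rewrite -subr_eq0; apply/eqP; rewrite -[LHS]opprK -[RHS]oppr0; congr (- _).
have : - b - alpha (t i) = 0 by rewrite bh hi subrr.
by rewrite /b cc2 opprB scaler_nat mulr2n opprB => <-; rewrite addrAC addrK.
Qed.

(** * Automorphisms of the root system *)

Lemma root_autW f b : root_aut Phi f -> is_root b -> is_root (f b).
Proof. by case=> _ fP; rewrite /is_root fP. Qed.

Lemma root_aut_id : root_aut Phi \1%VF.
Proof.
split=> [|v]; last by rewrite id_lfunE.
by apply/lker0P=> u v; rewrite !id_lfunE.
Qed.

Lemma root_aut_comp f g :
  root_aut Phi f -> root_aut Phi g -> root_aut Phi (f \o g)%VF.
Proof.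
move=> [/lker0P f_inj fP] [/lker0P g_inj gP]; split=> [|v]; last first.
  by rewrite comp_lfunE fP gP.
by apply/lker0P=> u v; rewrite !comp_lfunE => /f_inj/g_inj.
Qed.

Lemma root_aut_inv f : root_aut Phi f -> root_aut Phi f^-1%VF.
Proof.
move=> [f0 fP]; split=> [|v]; last by rewrite -fP lker0_lfunVK.
by apply/lker0P; apply: can_inj (lker0_lfunVK f0).
Qed.

Lemma root_aut_word s : root_aut Phi (refl_word s).
Proof. by split=> [|v]; [apply: word_inj | apply: root_word]. Qed.

(** The comparison of Cartan integers is one-sided; applied to [f] and to its inverse it gives
    equality. *)
Lemma root_aut_perm_diagram f (t : 'S_l) : root_aut Phi f ->
  (forall i, f (a i) = a (t i)) -> t \in diagram_sym alpha.
Proof.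
move=> Af fE; have Vf := root_aut_inv Af.
have VfE h : (f^-1)%VF (a h) = a (t^-1 h)%g.
  by rewrite -{1}[h](permKV t) -fE lker0_lfunK ?Af.1.
rewrite inE; apply/forallP=> j; apply/forallP=> i.
have [->|ne_ij] := eqVneq i j; first by rewrite !cartan_simple.
rewrite eq_le (cartan_perm_le (fun b => root_autW Af) fE) //=.
rewrite -{1}[j](permK t) -{1}[i](permK t).
rewrite (cartan_perm_le (fun b => root_autW Vf) VfE) //.
by rewrite (inj_eq perm_inj).
Qed.

(** The preimage [b] of a simple root is positive, since otherwise [f] would make the opposite of
    that simple root positive. Were [b] not simple, it would be [r j b + c *: a j] with [r j b]
    positive and [c > 0], and its image would have height greater than 1. *)
Lemma pos_aut_perm f : root_aut Phi f -> (forall b, is_pos b -> is_pos (f b)) ->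
  exists t : 'S_l, forall i, f (a i) = a (t i).
Proof.
move=> Af pos_f; have Vf := root_aut_inv Af; have fVK := lker0_lfunVK Af.1.
have /fin_all_exists[t tP] i : exists j, f (a j) = a i.
  have pos_i : is_pos ((f^-1)%VF (a i)).
    apply: contraT => /(neg_root (root_autW Vf (root_simple i)))/pos_f.
    rewrite linearN /= fVK => /andP[_].
    by rewrite heightN height_simple oppr_gt0 ltNge ler01.
  have [[j jE]|[j [pos_j c_gt0 _]]] := pos_split pos_i.
    by exists j; rewrite -jE fVK.
  have := pos_ge1 (pos_f _ pos_j); have := pos_ge1 (pos_f _ (pos_simple j)).
  rewrite [in X in _ -> X -> _]simple_reflE linearB linearZ /= fVK.
  rewrite heightD heightN heightZ height_simple => fj_ge1.
  set c := cartan _ _ in c_gt0 * => c_ge.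
  have : 0 < c * height (f (a j)) by rewrite mulr_gt0 // (lt_le_trans ltr01).
  by move=> ch_gt0; exfalso; lra.
have t_inj : injective t.
  by move=> i j tij; apply: vsproj_simple_inj; rewrite /= -(tP i) tij tP.
(* [t] picks preimages, hence the inverse. *)
exists (perm t_inj)^-1%g => i.
by rewrite -{1}[i](permKV (perm t_inj)) permE tP.
Qed.

(** Positive roots arise from simple ones by adding positive multiples of simple roots, so if all
    simple roots stay positive, so do all positive roots. *)
Lemma simple_neg f b : root_aut Phi f -> is_pos b -> ~~ is_pos (f b) ->
  exists i, ~~ is_pos (f (a i)).
Proof.
move=> Af pb nfb; apply/existsP; apply: contraNT nfb => /existsPn pos_f.
have {}pos_f i : is_pos (f (a i)) by have := pos_f i; rewrite negbK.
move: b pb; apply: pos_ind => // i b pb _ c_gt0.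
rewrite simple_reflE linearB linearZ /= => /andP[_].
rewrite heightD heightN heightZ => h_gt0.
rewrite /is_pos (root_autW Af (andP pb).1) /=.
have := mulr_gt0 c_gt0 (andP (pos_f i)).2; lra.
Qed.

(* Composing with a simple reflection whose root is sent to a negative root
   decreases the number of positive roots sent to negative ones by 1. *)
Lemma root_aut_word_perm f : root_aut Phi f ->
  exists s (t : 'S_l), forall i, f (refl_word s (a i)) = a (t i).
Proof.
(* [Phi] may list a root several times; once repetitions are removed, [rem] takes [a i] away
   altogether. *)
pose P : seq V := undup [seq b <- map (vsproj <<Phi>>%VS) Phi | is_pos b].
have P_uniq : uniq P by apply: undup_uniq.
have PE b : (b \in P) = is_pos b.
  rewrite mem_undup mem_filter andb_idr // => /andP[rb _].
  by apply/mapP; exists (vsval b); rewrite ?vsvalK.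
pose N f := count (fun b => ~~ is_pos (f b)) P : nat.
have [m] := ubnP (N f); elim: m => // m IHm in f *; rewrite ltnS => lt_Nm Af.
have [|no_neg] := boolP (has (fun b => ~~ is_pos (f b)) P); last first.
  have [|t tP] := pos_aut_perm Af.
    move=> b; rewrite -PE => Pb.
    by have /hasPn/(_ b Pb) := no_neg; rewrite negbK.
  by exists [::], t => i; rewrite id_lfunE.
case/hasP=> b; rewrite PE => pb /(simple_neg Af pb)[i neg_i].
have Afr : root_aut Phi (f \o r i)%VF.
  by apply: root_aut_comp => //; rewrite -word1; apply: root_aut_word.
have Pi : a i \in P by rewrite PE pos_simple.
suff lt_N : (N (f \o r i)%VF < N f)%N.
  have [s [t tP]] := IHm _ (leq_trans lt_N lt_Nm) Afr.
  by exists (i :: s), t => j; rewrite -tP !comp_lfunE.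
rewrite /N !(seq.permP (perm_to_rem Pi)) /= neg_i comp_lfunE simple_refl_simple.
rewrite linearN neg_root //= ?add0n ?add1n ?ltnS; last first.
  exact: root_autW Af (root_simple i).
(* The simple reflection permutes the positive roots other than [a i], so the remaining counts
   agree. *)
have /seq.permP-> : perm_eq (rem (a i) P) (map (r i) (rem (a i) P)).
  have r_inj := can_inj (simple_reflK i).
  have rem_r b' : b' \in rem (a i) P -> r i b' \in rem (a i) P.
    rewrite !mem_rem_uniq // !inE !PE => /andP[ne pb'].
    rewrite pos_simple_refl // andbT; apply: contraTneq pb' => rb'.
    by rewrite -(simple_reflK i b') rb' simple_refl_simple /is_pos heightN
      height_simple oppr_gt0 ltr10 andbF.
  apply: uniq_perm; rewrite ?map_inj_uniq ?rem_uniq // => b'.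
  apply/idP/mapP=> [/rem_r rb'|[b'' /rem_r rb'' ->] //].
  by exists (r i b') => //; rewrite simple_reflK.
by rewrite count_map; apply/eq_leq/eq_count => b' /=;
  rewrite comp_lfunE simple_reflK.
Qed.

(** Defined for every permutation of the simple roots, which makes it an anti-morphism for
    composition on all of ['S_l]; it preserves the roots exactly when [t] is a diagram symmetry. *)
Definition diagram_aut (t : 'S_l) : 'End(V) := sval (simple_extension t).

Lemma diagram_autE (t : 'S_l) i : diagram_aut t (a i) = a (t i).
Proof. exact: svalP (simple_extension t) i. Qed.

Lemma diagram_aut1 : diagram_aut 1 = \1%VF.
Proof.
by apply: lfun_eq_on_simple => i; rewrite diagram_autE perm1 id_lfunE.
Qed.

Lemma diagram_autM (s t : 'S_l) :
  diagram_aut (s * t)%g = (diagram_aut t \o diagram_aut s)%VF.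
Proof.
by apply: lfun_eq_on_simple => i; rewrite comp_lfunE !diagram_autE permM.
Qed.

Lemma diagram_aut_inj : injective diagram_aut.
Proof.
move=> s t st; apply/permP=> i; apply: vsproj_simple_inj.
by rewrite /= -(diagram_autE s) st diagram_autE.
Qed.

Lemma diagram_autK (t : 'S_l) : cancel (diagram_aut t) (diagram_aut t^-1%g).
Proof.
by move=> v; rewrite -comp_lfunE -diagram_autM mulgV diagram_aut1 id_lfunE.
Qed.

Lemma lker_diagram_aut (t : 'S_l) : lker (diagram_aut t) == 0%VS.
Proof. by apply/lker0P; apply: can_inj (diagram_autK t). Qed.

Section DiagramSym.
Variables (t : 'S_l) (Dt : t \in diagram_sym alpha).

(** Invariance of the Cartan integers is what makes both sides agree on the simple roots. *)
Lemma diagram_aut_refl i :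
  (diagram_aut t \o r i)%VF = (r (t i) \o diagram_aut t)%VF.
Proof.
move: Dt; rewrite inE => /forallP/(_ _)/forallP tP.
apply: lfun_eq_on_simple => j; rewrite !comp_lfunE diagram_autE !simple_reflE.
by rewrite linearB linearZ /= !diagram_autE !vsval_simple (eqP (tP j i)).
Qed.

Lemma diagram_aut_word s :
  (diagram_aut t \o refl_word s)%VF = (refl_word (map t s) \o diagram_aut t)%VF.
Proof.
elim: s => [|i s IHs]; first by rewrite comp_lfun1l comp_lfun1r.
rewrite map_cons !word_cons comp_lfunA diagram_aut_refl.
by rewrite -[LHS]comp_lfunA IHs comp_lfunA.
Qed.

Lemma diagram_aut_root b : is_root b -> is_root (diagram_aut t b).
Proof.
move=> rb; have [s [i ->]] := root_wordE rb; rewrite -comp_lfunE.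
by rewrite diagram_aut_word comp_lfunE root_word diagram_autE root_simple.
Qed.

End DiagramSym.

Lemma root_aut_diagram (t : 'S_l) :
  t \in diagram_sym alpha -> root_aut Phi (diagram_aut t).
Proof.
move=> Dt; split=> [|v]; first exact: lker_diagram_aut.
rewrite -/(is_root (diagram_aut t v)) -/(is_root v); apply/idP/idP;
  last exact: diagram_aut_root.
rewrite -{2}(diagram_autK t v); apply: diagram_aut_root.
exact: (@groupVr _ (diagram_sym_group alpha) _ Dt).
Qed.

Lemma root_aut_decomp f : root_aut Phi f ->
  exists s t, t \in diagram_sym alpha /\ f = (refl_word s \o diagram_aut t)%VF.
Proof.
move=> Af; have [s [t tP]] := root_aut_word_perm Af.
have fE : (f \o refl_word s)%VF = diagram_aut t.
  by apply: lfun_eq_on_simple => i; rewrite comp_lfunE tP diagram_autE.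
have Dt : t \in diagram_sym alpha.
  apply: (root_aut_perm_diagram (f := (f \o refl_word s)%VF)) => [|i].
    exact: root_aut_comp (root_aut_word s).
  by rewrite fE diagram_autE.
(* [f] is the diagram automorphism after the inverse word; moving that automorphism to the right
   renames the letters by [t]. *)
exists (map t (rev s)), t; split=> //; rewrite -diagram_aut_word // -fE.
by rewrite -comp_lfunA -{1}[s]revK word_rev comp_lfun1r.
Qed.

Lemma lin_group_root_aut : lin_group (root_aut Phi).
Proof.
split; [exact: root_aut_id | exact: root_aut_comp | move=> f Af].
by split; [case: Af | apply: root_aut_inv].
Qed.

Lemma lin_group_weyl : lin_group (weyl Phi).
Proof.
split; [exact: lin_generated_id | exact: lin_generated_comp | move=> f Wf].
split; last exact: lin_generated_inv.
by have /weyl_word[s ->] := Wf; apply: word_inj.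
Qed.

Lemma weyl_root_aut f : weyl Phi f -> root_aut Phi f.
Proof. by case/weyl_word=> s ->; apply: root_aut_word. Qed.

(** Write an automorphism as a word after a diagram automorphism: conjugation by the latter renames
    letters, conjugation by the former stays among words. *)
Lemma weyl_normal : lin_normal (weyl Phi) (root_aut Phi).
Proof.
split=> [|f g /root_aut_decomp[s [t [Dt ->]]] /weyl_word[s' ->]].
  exact: weyl_root_aut.
apply/weyl_word; exists (s ++ map t s' ++ rev s).
have AE : ((refl_word s \o diagram_aut t)^-1 =
    diagram_aut t^-1%g \o refl_word (rev s))%VF.
  have A_inj : lker (refl_word s \o diagram_aut t)%VF == 0%VS.
    apply/lker0P=> u v; rewrite !comp_lfunE.
    by move/(can_inj (word_revK s))/(can_inj (diagram_autK t)).
  rewrite -[RHS](lker0_compfK A_inj) -(comp_lfunA _ _ (_ \o _)).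
  by rewrite (comp_lfunA _ (refl_word s)) word_rev comp_lfun1l -diagram_autM
    mulgV diagram_aut1 comp_lfun1l.
rewrite AE !word_cat !comp_lfunA; congr (_ \o _)%VF.
rewrite -(comp_lfunA _ (diagram_aut t)) diagram_aut_word // -!comp_lfunA.
by rewrite -diagram_autM mulVg diagram_aut1 comp_lfun1r.
Qed.

Lemma weyl_diagram_aut (t : 'S_l) :
  weyl Phi (diagram_aut t) -> diagram_aut t = \1%VF.
Proof.
case/weyl_word=> s tE; rewrite tE; apply: pos_word_id => i.
by rewrite -tE diagram_autE pos_simple.
Qed.

Lemma diagram_aut_extends (t : 'S_l) : diagram_extends alpha t (diagram_aut t).
Proof. exact: diagram_autE. Qed.

Lemma root_aut_sdprod :
  lin_sdprod (root_aut Phi) (weyl Phi) (diagram_sym_group alpha) diagram_aut.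
Proof.
split.
- by split; [apply: lin_group_root_aut | apply: lin_group_weyl].
- exact: weyl_normal.
- split; last exact: root_aut_diagram.
  by split=> [s t _ _ /diagram_aut_inj|s t _ _]; last exact: diagram_autM.
- by move=> t _; apply: weyl_diagram_aut.
- move=> f /root_aut_decomp[s [t [Dt ->]]]; exists (refl_word s), t.
  by split=> //; apply/weyl_word; exists s.
Qed.

Lemma root_aut_weyl : diagram_sym alpha = [set 1%g] ->
  forall f, root_aut Phi f <-> weyl Phi f.
Proof.
move=> D1 f; split=> [/root_aut_decomp[s [t [Dt ->]]]|/weyl_root_aut//].
move: Dt; rewrite D1 inE => /eqP->; rewrite diagram_aut1 comp_lfun1r.
by apply/weyl_word; exists s.
Qed.

(** * The Weyl group as a group of permutations *)

Section PermutationRestriction.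
Variable p : 'I_l -> 'S_n.
Hypothesis pP : forall i, perm_restricts (p i) (r i).
Hypothesis span_faithful : forall s : 'S_n,
  {in <<Phi>>%VS, forall x : 'rV_n, x *m perm_mx s = x} -> s = 1%g.

Let H := <<[set p i | i : 'I_l]>>%G.

(** Total on ['S_n] because the image is projected back to the span; it is the restriction only when
    the permutation preserves the span. *)
Definition span_restriction (s : 'S_n) : 'End(V) :=
  linfun (vsproj <<Phi>>%VS \o mulmxr (perm_mx s) \o vsval).

Lemma perm_restrictsM (s t : 'S_n) f g :
  perm_restricts s f -> perm_restricts t g ->
  perm_restricts (s * t)%g (g \o f)%VF.
Proof. by move=> sf tg v; rewrite perm_mxM mulmxA sf tg comp_lfunE. Qed.

Lemma perm_restricts1 : perm_restricts (1%g : 'S_n) (\1%VF : 'End(V)).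
Proof. by move=> v; rewrite perm_mx1 mulmx1 id_lfunE. Qed.

Lemma span_restrictionE (s : 'S_n) f :
  perm_restricts s f -> span_restriction s = f.
Proof. by move=> sf; apply/lfunP=> v; rewrite lfunE /= sf vsvalK. Qed.

Lemma restricts_generated s : s \in H ->
  exists2 f, weyl Phi f & perm_restricts s f.
Proof.
case/gen_prodgP=> m [c c_in ->]; elim/big_rec: _ => [|k s' _ [f Wf sf]].
  by exists \1%VF; [apply: lin_generated_id | apply: perm_restricts1].
have /imsetP[i _ ->] := c_in k; exists (f \o r i)%VF.
  apply: lin_generated_comp => //; apply: lin_generated_in.
  by exists (alpha i); rewrite ?(rb_simple base).
exact: perm_restrictsM.
Qed.

Lemma word_restricts s : exists2 x, x \in H & perm_restricts x (refl_word s).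
Proof.
elim: s => [|i s [x Hx xs]]; first by exists 1%g; [|apply: perm_restricts1].
exists (x * p i)%g; last exact: perm_restrictsM.
by rewrite groupM // mem_gen // imset_f.
Qed.

(** The generators restrict to the simple reflections, which gives surjectivity; injectivity is the
    faithfulness of permutations on the span. *)
Lemma weyl_restriction_isom : restriction_isom H (weyl Phi).
Proof.
have resP s : s \in H -> perm_restricts s (span_restriction s).
  by case/restricts_generated=> f _ sf; rewrite (span_restrictionE sf).
exists span_restriction; split=> //; last first.
  move=> f; split=> [/weyl_word[s ->]|[s /restricts_generated[g Wg sg] ->]].
    have [x Hx xs] := word_restricts s.
    by exists x => //; rewrite (span_restrictionE xs).
  by rewrite (span_restrictionE sg).
split=> [s t Hs Ht eq_st|s t Hs Ht]; last first.
  by apply: span_restrictionE; apply: perm_restrictsM; apply: resP.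
apply/eqP; rewrite eq_mulgV1; apply/eqP/span_faithful => x Vx.
rewrite perm_mxM mulmxA -(vsprojK Vx) (resP s Hs) eq_st -(resP t Ht) -mulmxA.
by rewrite -perm_mxM mulgV perm_mx1 mulmx1.
Qed.

End PermutationRestriction.
End RootBase.

(** * Permutations and reversal of the coordinates *)

Section Reversal.
Variables (R : realFieldType) (n : nat).
Implicit Types (x : 'rV[R]_n) (a b : 'I_n).
Local Notation delta a := (delta_mx 0 a : 'rV[R]_n).

Definition rev_odd x : Prop := forall a, x 0 (rev_ord a) = - x 0 a.

(** Reversing the index changes the sign, and at the middle coordinate of an odd number the vector
    is zero; hence the recurring condition [rev_ord a != a]. *)
Definition rev_diff a : 'rV[R]_n := delta a - delta (rev_ord a).

Lemma dot_delta x a : dot x (delta a) = x 0 a.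
Proof.
rewrite /dot (bigD1 a) //= big1 => [|i ia]; last first.
  by rewrite mxE (negbTE ia) andbF mulr0.
by rewrite mxE !eqxx mulr1 addr0.
Qed.

Lemma delta_entry a b : (delta a) 0 b = (b == a)%:R.
Proof. by rewrite mxE eqxx. Qed.

(** For [a != b] this is the reflection in [delta a - delta b]: its squared length is 2, so the
    Cartan integer is the difference of the two coordinates. *)
Lemma mul_tperm_mx x a b :
  x *m perm_mx (tperm a b) = x - (x 0 a - x 0 b) *: (delta a - delta b).
Proof.
rewrite -[tperm a b]invgK -col_permE tpermV; apply/rowP=> j; rewrite !mxE /=.
case: tpermP => [->|->|/eqP/negbTE-> /eqP/negbTE->]; last by rewrite /=; ring.
  by have [->|ab] := eqVneq a b; rewrite ?eqxx ?(negbTE ab) /=; ring.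
by have [->|ab] := eqVneq b a; rewrite ?eqxx ?(negbTE ab) /=; ring.
Qed.

(** A reflection depends only on the line of its root; in type C this replaces [2 *: e 1] by
    [e 1]. *)
Lemma cartan_scale k x y : k != 0 ->
  cartan x (k *: y) *: (k *: y) = cartan x y *: y.
Proof.
move=> k0; rewrite /cartan scalerA dotZl !dotZr.
have [->|/dot_gt0/lt0r_neq0 y0] := eqVneq y 0; first by rewrite !scaler0.
by congr (_ *: _); field; rewrite y0.
Qed.

Lemma rev_odd_rev_diff a : rev_odd (rev_diff a).
Proof.
move=> b; rewrite !mxE !eqxx /= (can2_eq rev_ordK rev_ordK).
by rewrite (inj_eq (can_inj rev_ordK)) opprB.
Qed.

Lemma rev_odd_span (s : seq 'rV[R]_n) x :
  (forall y, y \in s -> rev_odd y) -> x \in <<s>>%VS -> rev_odd x.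
Proof.
move=> hs /(coord_span (X := in_tuple s))-> a; rewrite !summxE -sumrN.
by apply: eq_bigr => i _; rewrite !mxE hs ?mulrN // mem_nth.
Qed.

Lemma mul_rev_tperm x a : rev_odd x -> rev_ord a != a ->
  x *m perm_mx (tperm a (rev_ord a)) =
    x - cartan x (rev_diff a) *: rev_diff a.
Proof.
move=> hx ne; rewrite mul_tperm_mx; congr (_ - _ *: _).
rewrite /cartan /rev_diff !(dotBl, dotBr, dot_delta) !delta_entry !eqxx.
by rewrite hx (negbTE ne) [a == _]eq_sym (negbTE ne) /=; field.
Qed.

(** On an odd vector both transpositions have the same coefficient [x 0 a - x 0 b], and their two
    directions add up to [rev_diff a - rev_diff b], of squared length 4. *)
Lemma mul_rev_tperm_pair x a b : rev_odd x ->
    uniq [:: a; b; rev_ord a; rev_ord b] ->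
  x *m perm_mx (tperm a b * tperm (rev_ord b) (rev_ord a))%g =
    x - cartan x (rev_diff a - rev_diff b) *: (rev_diff a - rev_diff b).
Proof.
move=> hx; rewrite /= !inE !negb_or -!andbA.
case/and5P=> ab aa' ab' ba' /and3P[bb' a'b' _].
rewrite perm_mxM mulmxA !mul_tperm_mx.
rewrite -addrA -opprD; congr (_ - _).
rewrite /cartan /rev_diff !(dotBl, dotBr, dot_delta) !delta_entry.
rewrite !mxE !eqxx /= !hx.
have neq (c d : 'I_n) : c != d -> ((c == d) = false) * ((d == c) = false).
  by move=> cd; rewrite [d == c]eq_sym (negbTE cd).
rewrite !(neq _ _ ab, neq _ _ aa', neq _ _ ab', neq _ _ ba', neq _ _ bb',
  neq _ _ a'b') /=.
set c := x 0 a - x 0 b.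
have -> : - x 0 b - c * (0 - 0) - (- x 0 a - c * (0 - 0)) = c.
  by rewrite /c; ring.
rewrite -scalerDr; congr (_ *: _); first by rewrite /c; field.
by rewrite opprB addrACA [RHS]addrACA; congr (_ + _); apply: addrC.
Qed.

(** The vector has entry 1 at [a], and its image can have entry 1 there only if [s] fixes [a]. *)
Lemma rev_diff_fixed (s : 'S_n) a : rev_ord a != a ->
  rev_diff a *m perm_mx s = rev_diff a -> s a = a.
Proof.
move=> ne; rewrite mulmxBl !delta_perm_mx => /(congr1 (fun x => x 0 a)).
rewrite !mxE !eqxx eq_sym [a == rev_ord a]eq_sym (negbTE ne) subr0 /=.
have [//|_] := eqVneq (s a) a; rewrite sub0r => /eqP.
by case: (a == _); rewrite ?oppr0 eq_sym ?oner_eq0 // -addr_eq0 -mulr2n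
  pnatr_eq0.
Qed.

(** Reversal fixes at most one index, and a permutation fixing all the others fixes that one too. *)
Lemma rev_diff_faithful (s : 'S_n) :
  (forall a, rev_ord a != a -> rev_diff a *m perm_mx s = rev_diff a) -> s = 1%g.
Proof.
move=> fix_s; have {}fix_s a : rev_ord a != a -> s a = a.
  by move=> ne; apply: rev_diff_fixed (fix_s a ne).
apply/permP=> a; rewrite perm1.
have [ra|/fix_s//] := eqVneq (rev_ord a) a.
have [rsa|/fix_s/perm_inj//] := eqVneq (rev_ord (s a)) (s a).
apply/val_inj; move/(congr1 val): ra; move/(congr1 val): rsa => /=.
have := ltn_ord a; have := ltn_ord (s a); lia.
Qed.

Lemma eps_delta a : eps R n a.+1 = delta a.
Proof. by apply/rowP=> j; rewrite !mxE eqSS eqxx. Qed.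

End Reversal.

Lemma sA_tperm n (a b : 'I_n) : b = a.+1 :> nat -> sA n b = tperm a b.
Proof.
move=> ba; have ab : b.-1 = a by rewrite ba.
by rewrite /sA ab !valK.
Qed.

(** * The classical root systems *)

Section ClassicalRoots.
Variables (R : realFieldType) (n l : nat) (Phi : seq 'rV[R]_n).
Variables (e : nat -> 'rV[R]_n) (a1 : 'rV[R]_n) (t : nat) (ms : seq R).
Implicit Types (b : 'rV[R]_n) (c d m : R) (i j k : nat).
Local Notation signs := (signs R).

(** The pairs of indices are unordered: in this form stability under signed permutations of the
    [e i] is immediate. *)
Definition pair_root b := exists i j c d,
  [/\ (1 <= i <= l)%N, (1 <= j <= l)%N, i != j,
      (c \in signs) && (d \in signs) & b = c *: e i + d *: e j].

Definition single_root b := exists i m c,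
  [/\ (1 <= i <= l)%N, m \in ms, c \in signs & b = c *: (m *: e i)].

Definition chain_simple k := if k == 1%N then a1 else e k - e k.-1.
Local Notation alpha := chain_simple.

(* The first simple root, twice the height of [e 1], and the multipliers of
   the [e i] that are roots, in types B, C and D. *)
Definition first_root_spec :=
  [\/ [/\ a1 = e 1, t = 2 & ms = [:: 1]],
      [/\ a1 = 2 *: e 1, t = 1%N & ms = [:: 2]]
    | [/\ (2 <= l)%N, a1 = e 1 + e 2, t = 0 & ms = [::]]].

Hypothesis l_gt0 : (0 < l)%N.
Hypothesis orth : forall i j, (1 <= i <= l)%N -> (1 <= j <= l)%N ->
  dot (e i) (e j) = (2 * (i == j))%:R.
Hypothesis PhiE : forall b, b \in Phi <-> pair_root b \/ single_root b.
Hypothesis spec : first_root_spec.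

Ltac dots :=
  rewrite ?(dotDl, dotBl, dotZl, dotNl) ?(dotDr, dotBr, dotZr, dotNr);
  rewrite ?orth; try lia.
Ltac split_eqs := repeat match goal with
  |- context [(?i == ?j :> nat)] => case: (eqVneq i j) => ? end;
  rewrite /= ?muln0 ?muln1; try (exfalso; lia).

Lemma signsP c : reflect (c = 1 \/ c = -1) (c \in signs).
Proof. by rewrite !inE; apply: (iffP orP) => -[/eqP|/eqP]; auto. Qed.

Lemma signsN c : c \in signs -> - c \in signs.
Proof. by case/signsP=> ->; rewrite ?opprK !inE eqxx ?orbT. Qed.

Lemma signsM c d : c \in signs -> d \in signs -> c * d \in signs.
Proof.
by case/signsP=> ->; case/signsP=> ->; rewrite ?mulN1r ?opprK ?mul1r !inE eqxx
  ?orbT.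
Qed.

Lemma pair_root_ordered b : pair_root b -> exists i j c,
  [/\ (1 <= i < j)%N, (j <= l)%N, c \in signs
    & b = c *: (e j + e i) \/ b = c *: (e j - e i)].
Proof.
case=> i [j [c [d [hi hj ij /andP[sc sd] ->]]]].
wlog lt_ij : i j c d hi hj ij sc sd / (i < j)%N.
  move=> th; have [ltij|leji] := ltnP i j; first exact: (th i j c d).
  rewrite addrC; apply: (th j i d c) => //; rewrite ?sd // 1?eq_sym //.
  by rewrite ltn_neqAle eq_sym ij.
exists i, j, d; split=> //; [lia | lia | rewrite scalerDr scalerBr addrC].
case/signsP: sc sd => -> /signsP[]->; rewrite ?scaleN1r ?scale1r ?opprK; auto.
Qed.

(** Half the sum of the positive coroots. Since [dot (e k) (e k)] is 2, the coefficient is half of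
    the intended height [t / 2 + (k - 1)] of [e k]: heights rise by 1 along the chain, and [t] gives
    the first simple root height 1. *)
Definition classical_rho :=
  \sum_(1 <= k < l.+1) ((t%:R / 2 + k.-1%:R) / 2) *: e k.
Local Notation rho := classical_rho.

Lemma height_e i : (1 <= i <= l)%N -> dot (e i) rho = t%:R / 2 + i.-1%:R.
Proof.
move=> hi; rewrite dotC dot_suml (bigD1_seq i) ?iota_uniq //=; last first.
  by rewrite mem_index_iota.
rewrite big_seq_cond big1 ?addr0 => [|k /andP[]].
  by rewrite dotZl orth // eqxx muln1; field.
rewrite mem_index_iota => hk ki.
by rewrite dotZl orth // (negbTE ki) mulr0.
Qed.

Lemma chain_simple_root k : (1 <= k <= l)%N -> alpha k \in Phi.
Proof.
move=> hk; apply/PhiE; rewrite /alpha; have [k1|k1] := eqVneq k 1%N.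
  case: spec => [] [].
  - move=> -> _ ms1; right; exists 1%N, 1, 1.
    by rewrite ms1 !inE !eqxx !scale1r; split=> //; lia.
  - move=> -> _ ms1; right; exists 1%N, 2, 1.
    by rewrite ms1 !inE !eqxx !scale1r; split=> //; lia.
  - move=> l2 -> _ _; left; exists 1%N, 2%N, 1, 1.
    by rewrite !inE !eqxx !scale1r; split=> //; lia.
left; exists k, k.-1, 1, (-1); rewrite !inE !eqxx orbT scale1r scaleN1r.
by split=> //; lia.
Qed.

Lemma height_chain_simple k : (1 <= k <= l)%N -> dot (alpha k) rho = 1.
Proof.
move=> hk; rewrite /alpha; have [_|k1] := eqVneq k 1%N.
  case: spec => [] [].
  - by move=> -> t2 _; rewrite height_e ?t2 //=; field.
  - by move=> -> t2 _; rewrite dotZl height_e ?t2 //=; field.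
  - by move=> l2 -> t2 _; rewrite dotDl !height_e ?t2 //=; field.
rewrite dotBl !height_e; try lia.
by case: k hk k1 => [|[|k]] // _ _; rewrite /= -[k.+1%:R]natr1; ring.
Qed.

Lemma height_sum i j : (1 <= i <= l)%N -> (1 <= j <= l)%N ->
  dot (e j + e i) rho = (t + i.-1 + j.-1)%:R.
Proof. by move=> hi hj; rewrite dotDl !height_e // !natrD; field. Qed.

Lemma height_diff i j : (1 <= i < j)%N -> (j <= l)%N ->
  dot (e j - e i) rho = (j - i)%:R.
Proof.
move=> hi hj; rewrite dotBl !height_e; try lia.
have -> : j.-1 = (j - i + i.-1)%N by lia.
by rewrite natrD; ring.
Qed.

Lemma height_single i m : m \in ms -> (1 <= i <= l)%N ->
  dot (m *: e i) rho = (if t == 2 then i else i.*2.-1)%:R.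
Proof.
move=> hm hi; rewrite dotZl height_e //; case: i hi => // i _ /=.
case: spec hm => [] []; last by move=> _ _ _ ->.
  by move=> _ -> ->; rewrite inE => /eqP->; rewrite eqxx -[i.+1%:R]natr1; field.
move=> _ -> ->; rewrite inE => /eqP-> /=.
by rewrite -[i.*2.+1%:R]natr1 -mul2n natrM; field.
Qed.

Lemma positive_rootsP b : b \in Phi -> exists c b',
  [/\ c \in signs, b = c *: b' &
    [\/ exists i j, [/\ (1 <= i < j)%N, (j <= l)%N & b' = e j + e i],
        exists i j, [/\ (1 <= i < j)%N, (j <= l)%N & b' = e j - e i]
      | exists i m, [/\ (1 <= i <= l)%N, m \in ms & b' = m *: e i]]].
Proof.
case/PhiE=> [/pair_root_ordered[i [j [c [hi hj sc [->|->]]]]]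
            |[i [m [c [hi hm sc ->]]]]].
- by exists c, (e j + e i); split=> //; constructor 1; exists i, j.
- by exists c, (e j - e i); split=> //; constructor 2; exists i, j.
- by exists c, (m *: e i); split=> //; constructor 3; exists i, m.
Qed.

(** [N] is the height minus 1. For a root that is not simple, a simple root with positive product is
    found at the smaller index for [e j + e i], at the larger one for [e j - e i], and at [i] for a
    multiple of [e i]. *)
Lemma height_positive b' :
    [\/ exists i j, [/\ (1 <= i < j)%N, (j <= l)%N & b' = e j + e i],
        exists i j, [/\ (1 <= i < j)%N, (j <= l)%N & b' = e j - e i]
      | exists i m, [/\ (1 <= i <= l)%N, m \in ms & b' = m *: e i]] ->
  exists2 N : nat, dot b' rho = N.+1%:R &
    if N is 0 then exists2 k, (1 <= k <= l)%N & b' = alpha k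
    else exists2 k, (1 <= k <= l)%N & 0 < dot b' (alpha k).
Proof.
case=> [[i [j [hi hj ->]]]|[i [j [hi hj ->]]]|[i [m [hi hm ->]]]].
- exists (t + i.-1 + j.-2)%N; first by
    rewrite height_sum; try lia; congr _%:R; lia.
  case E: (t + i.-1 + j.-2)%N => [|N].
    have [t0 i1 j2] : [/\ t = 0, i = 1 & j = 2] by split; lia.
    exists 1%N; first lia; rewrite /alpha /= i1 j2 addrC.
    by case: spec => [] [] //; rewrite t0.
  have [i1|i1] := eqVneq i 1%N.
    exists 1%N; first lia; rewrite /alpha /= i1.
    by case: spec => [] []; [move=> -> _ _|move=> -> _ _|move=> _ -> _ _];
      dots; split_eqs; lra.
  exists i; first lia; rewrite /alpha (negbTE i1); dots; split_eqs; lra.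
- exists (j - i).-1; first by rewrite height_diff //; congr _%:R; lia.
  have j1 : j != 1%N by lia.
  case E: (j - i).-1 => [|N]; exists j; rewrite /alpha ?(negbTE j1); try lia.
    by have -> : j.-1 = i by lia.
  by dots; split_eqs; lra.
- exists (if t == 2 then i else i.*2.-1).-1.
    by rewrite height_single //; congr _%:R; case: ifP; lia.
  have m_gt0 : 0 < m.
    by case: spec hm => [] []; [move=> _ _ ->|move=> _ _ ->|move=> _ _ _ ->];
      rewrite ?inE // => /eqP->.
  have [i1|i1] := eqVneq i 1%N.
    rewrite i1 if_same /=; exists 1%N; first lia; rewrite /alpha /=.
    by case: spec hm => [] []; [move=> -> _ ->|move=> -> _ ->|move=> _ _ _ ->];
      rewrite ?inE // => /eqP->; rewrite ?scale1r.
  case E: _.-1 => [|N]; first by move: E; case: ifP; lia.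
  exists i => //; rewrite /alpha (negbTE i1); dots; split_eqs.
  by rewrite subr0 pmulr_rgt0.
Qed.

Lemma cartan_e k i : (1 <= k <= l)%N -> (1 <= i <= l)%N -> k != 1%N ->
  cartan (e i) (alpha k) = (i == k)%:R - (i == k.-1)%:R.
Proof.
move=> hk hi k1; rewrite /cartan /alpha (negbTE k1); dots.
by split_eqs; rewrite ?subr0 ?sub0r; field.
Qed.

Lemma cartan_e1 :
  [\/ [/\ a1 = e 1, ms = [:: 1] & forall i, (1 <= i <= l)%N ->
          cartan (e i) (alpha 1) = (2 * (i == 1))%:R],
      [/\ a1 = 2 *: e 1, ms = [:: 2] & forall i, (1 <= i <= l)%N ->
          cartan (e i) (alpha 1) = (i == 1)%:R]
    | [/\ (2 <= l)%N, a1 = e 1 + e 2, ms = [::] & forall i, (1 <= i <= l)%N ->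
          cartan (e i) (alpha 1) = (i == 1)%:R + (i == 2)%:R]].
Proof.
case: spec => [[E1 _ Em]|[E1 _ Em]|[l2 E1 _ Em]];
  [constructor 1 | constructor 2 | constructor 3]; split=> // i hi;
  by rewrite /cartan /alpha E1 /=; dots; split_eqs; field.
Qed.

(** The reflection exchanges [e k] and [e k.-1] for [k > 1]; for [k = 1] it changes the sign of
    [e 1] in types B and C, and in type D it exchanges [e 1] and [e 2] with a change of sign. *)
Lemma chain_refl_signed_perm k : (1 <= k <= l)%N ->
  exists (sigma : nat -> nat) (sg : nat -> R),
    forall i, (1 <= i <= l)%N ->
      [/\ (1 <= sigma i <= l)%N, sg i \in signs,
          forall j, (1 <= j <= l)%N -> sigma i = sigma j -> i = j
        & e i - cartan (e i) (alpha k) *: alpha k = sg i *: e (sigma i)].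
Proof.
move=> hk; have [k1|k1] := eqVneq k 1%N; last first.
  exists (fun i => if i == k then k.-1 else if i == k.-1 then k else i).
  exists (fun=> 1) => i hi; split.
  - by split_eqs; lia.
  - by rewrite inE eqxx.
  - by move=> j hj; split_eqs; lia.
  rewrite cartan_e // /alpha (negbTE k1) scale1r.
  have [->|ik] := eqVneq i k.
    have -> : (k == k.-1) = false by lia.
    by rewrite subr0 scale1r subKr.
  have [->|ik'] := eqVneq i k.-1; last by rewrite subr0 scale0r subr0.
  by rewrite sub0r scaleN1r opprK addrC subrK.
have sgP i j : (if i == j then -1 else 1) \in signs.
  by case: ifP; rewrite !inE eqxx ?orbT.
rewrite k1; case: cartan_e1 => [[E1 _ cE]|[E1 _ cE]|[l2 E1 _ cE]].
- exists id, (fun i => if i == 1%N then -1 else 1) => i hi; split=> //.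
  rewrite cE // /alpha /= E1; have [->|_] := eqVneq i 1%N.
    by rewrite scaleN1r scaler_nat mulr2n opprD addNKr.
  by rewrite scale0r subr0 scale1r.
- exists id, (fun i => if i == 1%N then -1 else 1) => i hi; split=> //.
  rewrite cE // /alpha /= E1; have [->|_] := eqVneq i 1%N.
    by rewrite scale1r scaleN1r scaler_nat mulr2n opprD addNKr.
  by rewrite scale0r subr0 scale1r.
- exists (fun i => if i == 1%N then 2 else if i == 2 then 1%N else i).
  exists (fun i => if (i <= 2)%N then -1 else 1) => i hi; split=> //.
  + by split_eqs; lia.
  + by case: ifP; rewrite !inE eqxx ?orbT.
  + by move=> j hj; split_eqs; lia.
  rewrite cE // /alpha /= E1; have [->|i1] := eqVneq i 1%N.
    by rewrite addr0 scale1r scaleN1r opprD addNKr.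
  have [->|i2] := eqVneq i 2.
    by rewrite add0r scale1r scaleN1r opprD addrCA subrr addr0.
  have -> : (i <= 2)%N = false by lia.
  by rewrite addr0 scale0r subr0 scale1r.
Qed.

Lemma chain_root_opp b : b \in Phi -> - b \in Phi.
Proof.
case/PhiE=> [[i [j [c [d [hi hj ij /andP[sc sd] ->]]]]]
            |[i [m [c [hi hm sc ->]]]]].
  apply/PhiE; left; exists i, j, (- c), (- d).
  by rewrite !signsN // !scaleNr opprD.
apply/PhiE; right; exists i, m, (- c).
by rewrite signsN // scaleNr.
Qed.

Lemma chain_root_refl k b : (1 <= k <= l)%N -> b \in Phi ->
  b - cartan b (alpha k) *: alpha k \in Phi.
Proof.
move=> /chain_refl_signed_perm[sigma [sg sgP]].
case/PhiE=> [[i [j [c [d [hi hj ij /andP[sc sd] ->]]]]]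
            |[i [m [c [hi hm sc ->]]]]].
  have [hi' si inj_i Ei] := sgP i hi; have [hj' sj inj_j Ej] := sgP j hj.
  apply/PhiE; left; exists (sigma i), (sigma j), (c * sg i), (d * sg j).
  rewrite !signsM //; split=> //; first by apply: contraNneq ij => /inj_i->.
  rewrite -(scalerA c) -(scalerA d) -Ei -Ej.
  rewrite cartanDl !cartanZl scalerDl opprD addrACA.
  by rewrite !scalerBr !scalerA.
have [hi' si _ Ei] := sgP i hi.
apply/PhiE; right; exists (sigma i), m, (c * sg i).
rewrite !signsM //; split=> //.
rewrite [RHS]scalerA mulrAC -[RHS]scalerA -Ei !cartanZl scalerBr !scalerA.
by rewrite mulrA.
Qed.

Lemma chain_cartan_le2 k b :
  (1 <= k <= l)%N -> b \in Phi -> cartan b (alpha k) <= 2.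
Proof.
move=> hk /PhiE[[i [j [c [d [hi hj ij /andP[sc sd] ->]]]]]
               |[i [m [c [hi hm sc ->]]]]].
  rewrite cartanDl !cartanZl; have [k1|k1] := eqVneq k 1%N; last first.
    rewrite !cartan_e //.
    by case/signsP: sc => ->; case/signsP: sd => ->; split_eqs; lra.
  rewrite k1; case: cartan_e1 => [[_ _ cE]|[_ _ cE]|[_ _ _ cE]]; rewrite !cE //;
    by case/signsP: sc => ->; case/signsP: sd => ->; split_eqs; lra.
rewrite !cartanZl; have [k1|k1] := eqVneq k 1%N; last first.
  have m12 : m = 1 \/ m = 2.
    by case: spec hm => [[_ _ ->]|[_ _ ->]|[_ _ _ ->]]; rewrite ?inE // => /eqP;
      auto.
  rewrite cartan_e //.
  by case/signsP: sc => ->; case: m12 => ->; split_eqs; lra.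
rewrite k1; case: cartan_e1 hm => [[_ -> cE]|[_ -> cE]|[_ _ -> _]];
  rewrite ?inE // cE // => /eqP->;
  by case/signsP: sc => ->; split_eqs; lra.
Qed.

Lemma chain_simple_obtuse i j : (1 <= i <= l)%N -> (1 <= j <= l)%N -> i != j ->
  dot (alpha i) (alpha j) <= 0.
Proof.
move=> hi hj; wlog lt_ij : i j hi hj / (i < j)%N => [th ij|_].
  have [lt|le] := ltnP i j; first exact: th.
  rewrite dotC; apply: th => //; last by rewrite eq_sym.
  by rewrite ltn_neqAle eq_sym ij.
have j1 : j != 1%N by lia.
rewrite /alpha (negbTE j1); have [i1|i1] := eqVneq i 1%N; last first.
  by dots; split_eqs; lra.
by case: spec => [[-> _ _]|[-> _ _]|[l2 -> _ _]]; dots; split_eqs; lra.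
Qed.

Lemma ordS_range (i : 'I_l) : (1 <= i.+1 <= l)%N.
Proof. by rewrite ltn_ord. Qed.

Lemma range_ordS k : (1 <= k <= l)%N -> exists i : 'I_l, k = i.+1.
Proof. by case: k => // k hk; exists (Ordinal hk). Qed.

Lemma classical_root_base : root_base Phi (fun i : 'I_l => alpha i.+1) rho.
Proof.
split.
- by move=> i; apply: chain_simple_root (ordS_range i).
- by move=> i; apply: height_chain_simple (ordS_range i).
- move=> b /positive_rootsP[c [b' [sc -> /height_positive[N hN _]]]].
  by exists N; rewrite dotZl hN; case/signsP: sc => ->; [left|right]; ring.
- move=> b /positive_rootsP[c [b' [sc -> /height_positive[N hN sN]]]].
  rewrite dotZl hN; case/signsP: sc => ->; last first.
    rewrite mulN1r => /eqP; rewrite lt_eqF // (lt_trans _ ltr01) //.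
    by rewrite oppr_lt0 ltr0n.
  rewrite mul1r => /eqP; rewrite pnatr_eq1 => /eqP[N0].
  move: sN; rewrite N0 => -[k /range_ordS[i ->] ->].
  by exists i; rewrite scale1r.
- exact: chain_root_opp.
- by move=> i b; apply: chain_root_refl (ordS_range i).
- by move=> i b; apply: chain_cartan_le2 (ordS_range i).
- by move=> i j ij; apply: chain_simple_obtuse (ordS_range i) (ordS_range j) _.
- move=> b /positive_rootsP[c [b' [sc -> /height_positive[N hN sN]]]].
  rewrite dotZl hN; case/signsP: sc => ->; last first.
    move=> lt1; have := lt_trans ltr01 lt1; rewrite mulN1r.
    by rewrite oppr_gt0 ltrn0.
  rewrite mul1r scale1r ltr1n ltnS; case: N sN {hN} => // N [k].
  by move=> /range_ordS[i ->]; exists i.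
Qed.

(** Only [e 1] needs an argument: it is the first simple root up to a factor, or in type D half the
    difference of the first two. The other vectors follow along the chain. *)
Lemma span_classical : <<Phi>>%VS = <<[seq e k | k <- iota 1 l]>>%VS.
Proof.
have mem_e i : (1 <= i <= l)%N -> e i \in <<[seq e k | k <- iota 1 l]>>%VS.
  by move=> hi; apply/memv_span/map_f; rewrite mem_iota add1n.
apply/eqP; rewrite eqEsubv; apply/andP; split; apply/span_subvP.
  move=> b /PhiE[[i [j [c [d [hi hj _ _ ->]]]]]|[i [m [c [hi _ _ ->]]]]].
    by rewrite rpredD ?rpredZ ?mem_e.
  by rewrite !rpredZ ?mem_e.
move=> _ /mapP[k hk ->]; move: hk; rewrite mem_iota add1n => hk.
have alphaP i : (1 <= i <= l)%N -> alpha i \in <<Phi>>%VS.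
  by move/chain_simple_root/memv_span.
have {alphaP} e1 : e 1 \in <<Phi>>%VS /\
    forall i, (1 < i <= l)%N -> e i - e i.-1 \in <<Phi>>%VS.
  have alphaS i : (1 < i <= l)%N -> e i - e i.-1 \in <<Phi>>%VS.
    by case: i => [|[|i]] // hi; apply: (alphaP i.+2).
  split=> //; have := alphaP 1%N l_gt0; rewrite /alpha /=.
  case: spec => [[-> _ _]//|[-> _ _]|[l2 -> _ _]].
    by rewrite rpredZeq pnatr_eq0.
  move=> h12; have := alphaS 2 l2; rewrite /= => h21.
  have := rpredB h12 h21; rewrite opprB addrACA subrr addr0 -mulr2n -scaler_nat.
  by rewrite rpredZeq pnatr_eq0.
case: e1 => e1 eS; elim: k hk => // -[|k] IHk hk //.
rewrite -[e k.+2](subrK (e k.+1)) rpredD //; first by apply: (eS k.+2).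
by apply: IHk; lia.
Qed.


(** * Symmetries of the classical diagrams *)

Local Notation simples := (fun i : 'I_l => alpha i.+1).

Lemma chain_norm_gt0 k : (1 <= k <= l)%N -> 0 < dot (alpha k) (alpha k).
Proof.
by case/range_ordS=> i ->; apply: simple_norm_gt0 classical_root_base i.
Qed.

Lemma diagram_sym_cartan (s : 'S_l) (i j : 'I_l) : s \in diagram_sym simples ->
  cartan (alpha (s i).+1) (alpha (s j).+1) = cartan (alpha i.+1) (alpha j.+1).
Proof. by rewrite inE => /forallP/(_ i)/forallP/(_ j)/eqP. Qed.

(** Orthogonality is the absence of an edge, so a symmetry can be handled as a graph automorphism
    wherever lengths do not matter. *)
Lemma diagram_sym_orth (s : 'S_l) (i j : 'I_l) : s \in diagram_sym simples ->
  (dot (alpha (s i).+1) (alpha (s j).+1) == 0) =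
  (dot (alpha i.+1) (alpha j.+1) == 0).
Proof.
have E (i' j' : 'I_l) : (cartan (alpha i'.+1) (alpha j'.+1) == 0) =
    (dot (alpha i'.+1) (alpha j'.+1) == 0).
  rewrite /cartan !mulf_eq0 invr_eq0 pnatr_eq0 /= orbC.
  by rewrite gt_eqF ?chain_norm_gt0 ?ordS_range.
by move=> Ds; rewrite -!E diagram_sym_cartan.
Qed.

Lemma chain_orthE i j : (2 <= i <= l)%N -> (2 <= j <= l)%N -> i != j ->
  (dot (alpha i) (alpha j) == 0) = (j != i.+1) && (i != j.+1).
Proof.
move=> hi hj ij; rewrite /alpha.
have [-> ->] : (i == 1%N) = false /\ (j == 1%N) = false by lia.
have [adj|nadj] := boolP ((j == i.+1) || (i == j.+1)).
  have -> : (j != i.+1) && (i != j.+1) = false by lia.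
  by apply: lt_eqF; dots; split_eqs; lra.
by rewrite -negb_or nadj; apply/eqP; dots; split_eqs; lra.
Qed.

(** The only neighbour of node 1 is node 3 in type D ([t = 0]) and node 2 otherwise. *)
Lemma chain_orth1E j : (2 <= j <= l)%N ->
  (dot (alpha 1) (alpha j) == 0) = (j != if t == 0 then 3 else 2).
Proof.
move=> hj; have j1 : (j == 1%N) = false by lia.
rewrite /alpha /= j1; case: spec => [[-> -> _]|[-> -> _]|[l2 -> -> _]] /=;
  [have [j2|nadj] := eqVneq j 2 | have [j2|nadj] := eqVneq j 2
  | have [j3|nadj] := eqVneq j 3];
  rewrite /=; by [apply: lt_eqF; dots; split_eqs; lra
                 |apply/eqP; dots; split_eqs; lra].
Qed.

(** The image of [z] is joined to [y] and differs from [x]. Besides [x] and [z] only node 1 could be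
    joined to [y], and the disjunction excludes it as an image. Ordinals count from 0, nodes from
    1. *)
Lemma diagram_sym_next (s : 'S_l) (x y z : 'I_l) : s \in diagram_sym simples ->
    (2 <= y.+1)%N -> y = x.+1 :> nat -> z = y.+1 :> nat ->
    (x = 0%N :> nat) \/ (y.+1 != if t == 0 then 3 else 2) ->
  s x = x -> s y = y -> s z = z.
Proof.
move=> Ds y_ge yx zy y1 sx sy; have := diagram_sym_orth z y Ds; rewrite sy.
have := ltn_ord z; have := ltn_ord (s z) => ltsz ltz.
rewrite (@chain_orthE z.+1 y.+1); try lia.
have szx : s z <> x :> nat.
  by move/ord_inj; rewrite -{1}sx => /perm_inj/(congr1 val)/=; lia.
have szy : s z <> y :> nat.
  by move/ord_inj; rewrite -{1}sy => /perm_inj/(congr1 val)/=; lia.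
rewrite zy eqxx andbF /= => adj.
apply: val_inj => /=; move: adj; have [sz0|sz0] := eqVneq (s z : nat) 0%N.
  rewrite sz0 chain_orth1E; last by lia.
  by case: y1 => [x0|-> //]; move: szx; rewrite sz0 x0.
by rewrite chain_orthE; lia.
Qed.

(** Two consecutive fixed nodes force the next one to be fixed, and so on up the chain. *)
Lemma diagram_sym_fix (s : 'S_l) k : s \in diagram_sym simples ->
    (1 <= k)%N -> (k = 1 /\ t != 0) \/ ((if t == 0 then 3 else 2) <= k)%N ->
    (forall x : 'I_l, (k.-1 <= x <= k)%N -> s x = x) ->
  forall x : 'I_l, (k.-1 <= x)%N -> s x = x.
Proof.
move=> Ds k1 hk fix_k x; have [m] := ubnP (x : nat); elim: m => // m IHm in x *.
move=> xm xk; have [le_xk|lt_kx] := leqP x k; first by apply: fix_k; rewrite xk.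
have hx2 : (x.-2 < l)%N by have := ltn_ord x; lia.
have hx1 : (x.-1 < l)%N by have := ltn_ord x; lia.
apply: (@diagram_sym_next s (Ordinal hx2) (Ordinal hx1)) => //=; try lia.
- case: hk => [[k1' t0]|hk]; last by right; move: hk; case: ifP => _; lia.
  rewrite (negbTE t0); have [x2|x2] := eqVneq (x : nat) 2; last by right; lia.
  by left; rewrite x2.
- by apply: IHm => /=; lia.
- by apply: IHm => /=; lia.
Qed.

(** The simple roots from the second on have equal length, so nodes 1 and 2 form the only joined
    pair with two different Cartan integers. Both are therefore fixed, and the rest of the chain
    follows. *)
Lemma diagram_sym_trivial : t != 0 -> diagram_sym simples = [set 1%g].
Proof.
move=> t0; apply/setP=> s; rewrite [RHS]inE.
apply/idP/eqP=> [|->]; last exact: (group1 (diagram_sym_group simples)).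
move=> Ds; have [l1|l2] := leqP l 1.
  apply/permP=> x; rewrite perm1; apply: ord_inj.
  by have := ltn_ord x; have := ltn_ord (s x); lia.
pose x := Ordinal l_gt0; pose y := Ordinal l2.
have long i j : (2 <= i <= l)%N -> (2 <= j <= l)%N ->
    cartan (alpha i) (alpha j) = cartan (alpha j) (alpha i).
  move=> hi hj; rewrite /cartan (dotC (alpha j)); congr (_ / _).
  have [i1 j1] : (i == 1%N) = false /\ (j == 1%N) = false by lia.
  by rewrite /alpha i1 j1; dots; split_eqs; lra.
have asym12 : cartan (alpha 1) (alpha 2) <> cartan (alpha 2) (alpha 1).
  rewrite /cartan (dotC (alpha 2)) => /mulfI.
  have -> : 2 * dot (alpha 1) (alpha 2) != 0.
    by rewrite mulf_neq0 ?pnatr_eq0 // chain_orth1E ?(negbTE t0) ?eqxx.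
  move=> /(_ isT)/invr_inj; rewrite /alpha /=.
  by case: spec t0 => [[-> _ _]|[-> _ _]|[_ _ -> _]] // _; dots; split_eqs; lra.
have sxy : s x <> s y :> nat by move/ord_inj/perm_inj/(congr1 val).
have adj := diagram_sym_orth x y Ds; have Cxy := diagram_sym_cartan x y Ds.
have Cyx := diagram_sym_cartan y x Ds.
have := ltn_ord (s x); have := ltn_ord (s y) => ltsy ltsx.
have [sx0 sy1] : s x = 0%N :> nat /\ s y = 1%N :> nat.
  rewrite chain_orth1E ?(negbTE t0) ?eqxx //= in adj.
  have [sx0|sx0] := eqVneq (s x : nat) 0%N.
    by move: adj; rewrite sx0 chain_orth1E ?(negbTE t0); lia.
  have [sy0|sy0] := eqVneq (s y : nat) 0%N.
    move: adj; rewrite sy0 dotC chain_orth1E ?(negbTE t0) /=; last lia.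
    move=> /negbFE/eqP[sx1]; case: asym12.
    by rewrite -[LHS]Cxy sy0 sx1.
  case: asym12; rewrite -[LHS]Cxy -[RHS]Cyx; apply: long; lia.
have sx : s x = x by apply: ord_inj.
have sy : s y = y by apply: ord_inj.
apply/permP=> z; rewrite perm1; apply: (@diagram_sym_fix s 1 Ds) => //.
  by left.
move=> z' /= hz'; have [z0|z0] := eqVneq (z' : nat) 0%N.
  by have -> : z' = x by apply: ord_inj.
by have -> : z' = y by apply: ord_inj => /=; lia.
Qed.

(** For [l > 4] node 3 is the only node with three neighbours, and node 4 its only neighbour that
    has a further one. For [l = 3] node 3 is the middle of a path. For [l = 4] nodes 1, 2 and 4
    cannot be told apart. *)
Lemma diagram_sym_D (l2 : (1 < l)%N) : t = 0 -> l != 4 ->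
  {in diagram_sym simples, forall s : 'S_l, s = 1%g \/ s = swap12 l2}.
Proof.
move=> t0 l4 s Ds.
have perm_end : (forall x : 'I_l, (2 <= x)%N -> s x = x) ->
    s = 1%g \/ s = swap12 l2.
  move=> fix_s; pose x := Ordinal (ltnW l2); pose y := Ordinal l2.
  have lt2 (z : 'I_l) : (z < 2)%N -> (s z < 2)%N.
    move=> lt_z2; rewrite ltnNge; apply/negP=> le_2s.
    have /perm_inj sz := fix_s _ le_2s.
    by move: le_2s; rewrite sz leqNgt lt_z2.
  have sxy : s x <> s y :> nat by move/ord_inj/perm_inj/(congr1 val).
  have := lt2 x isT; have := lt2 y isT => lt_sy lt_sx.
  have [sx|sx] := eqVneq (s x : nat) 0%N; [left | right]; apply/permP=> z;
    rewrite ?perm1 /swap12; apply: ord_inj;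
    (have [z2|z2] := leqP 2 z; first rewrite fix_s //).
  - have [z0|z0] := eqVneq (z : nat) 0%N.
      by have -> : z = x by apply: ord_inj.
    by have -> : z = y by [apply: ord_inj => /=; lia]; rewrite /=; lia.
  - by rewrite tpermD // -val_eqE /=; lia.
  - have [z0|z0] := eqVneq (z : nat) 0%N.
      by have -> : z = x by [apply: ord_inj]; rewrite tpermL /=; lia.
    by have -> : z = y by [apply: ord_inj => /=; lia]; rewrite tpermR /=; lia.
have [l3|l3] := leqP l 2; first by apply: perm_end => x; have := ltn_ord x; lia.
pose edge (i j : nat) := [|| (0 < i)%N && (j == i.+1), (0 < j)%N && (i == j.+1),
  (i == 0%N) && (j == 2) | (j == 0%N) && (i == 2)].
have orth_edge (x y : 'I_l) : x <> y :> nat ->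
    (dot (alpha x.+1) (alpha y.+1) == 0) = ~~ edge x y.
  move=> xy; have := ltn_ord x; have := ltn_ord y => lty ltx; rewrite /edge.
  have [x0|x0] := eqVneq (x : nat) 0%N.
    by rewrite x0 chain_orth1E ?t0 ?eqxx; lia.
  have [y0|y0] := eqVneq (y : nat) 0%N.
    by rewrite y0 dotC chain_orth1E ?t0 ?eqxx; lia.
  by rewrite chain_orthE; lia.
have s_edge (x y : 'I_l) : x <> y :> nat ->
    s x <> s y :> nat /\ edge (s x) (s y) = edge x y.
  move=> xy; have sxy : s x <> s y :> nat by move/ord_inj/perm_inj/(congr1 val).
  split=> //; apply: negb_inj.
  by rewrite -!orth_edge //; apply: diagram_sym_orth.
have lt_s (x : 'I_l) := ltn_ord (s x).
pose o0 := Ordinal l_gt0; pose o1 := Ordinal l2; pose o2 := Ordinal l3.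
have [n01 _] := @s_edge o0 o1 ltac:(by []).
have [n02 e02] := @s_edge o0 o2 ltac:(by []).
have [n12 e12] := @s_edge o1 o2 ltac:(by []).
have := (lt_s o0, lt_s o1, lt_s o2) => -[[lt0 lt1] lt2].
have [le_l3|lt_l3] := leqP l 3.
  apply: perm_end => x x2; have -> : x = o2.
    by apply: ord_inj => /=; have := ltn_ord x; lia.
  apply: ord_inj => /=; move: e02 e12; rewrite /edge /=; lia.
have l5 : (4 < l)%N by lia.
pose o3 := Ordinal lt_l3; pose o4 := Ordinal l5.
have [n03 _] := @s_edge o0 o3 ltac:(by []).
have [n13 _] := @s_edge o1 o3 ltac:(by []).
have [n23 e23] := @s_edge o2 o3 ltac:(by []).
have [n24 _] := @s_edge o2 o4 ltac:(by []).
have [n34 e34] := @s_edge o3 o4 ltac:(by []).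
have s2 : s o2 = 2 :> nat by move: e02 e12 e23; rewrite /edge /=; lia.
(* Otherwise node 4 would go to one of the two leaves at the branch node, and node 5 would have to
   go to the branch node itself. *)
have s3 : s o3 = 3 :> nat by move: e23 e34; rewrite /edge /= s2; lia.
apply: perm_end; apply: (@diagram_sym_fix s 3) => //.
  by right; rewrite t0.
move=> x /= hx; have [x2|x2] := eqVneq (x : nat) 2.
  by have -> : x = o2; apply: ord_inj.
by have -> : x = o3; apply: ord_inj => //=; lia.
Qed.

End ClassicalRoots.

(** * Reflections as permutations *)

Section PermutationWords.
Variable n : nat.
Implicit Types a b c d : 'I_n.

Lemma tperm_conj a b (s : 'S_n) :
  (tperm a b * s * tperm a b = s ^ tperm a b)%g.
Proof. by rewrite conjgE tpermV mulgA. Qed.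

Lemma tperm_braid a b c : a != b -> a != c -> b != c ->
  (tperm a b * tperm b c * tperm a b = tperm a c)%g /\
  (tperm b c * tperm a b * tperm b c = tperm a c)%g.
Proof.
move=> ab ac bc; rewrite !tperm_conj !tpermJ tpermR tpermL.
by rewrite !tpermD // eq_sym.
Qed.

Lemma tperm_disjointC a b c d : uniq [:: a; b; c; d] ->
  (tperm a b * tperm c d = tperm c d * tperm a b)%g.
Proof.
rewrite /= !inE !negb_or -!andbA => /and5P[ab ac ad bc /and3P[bd cd _]].
by rewrite conjgC tpermJ !tpermD // eq_sym.
Qed.

(** Conjugation by [(b c)] turns [(a b)(c d)] into [(a c)(b d)]; this evaluates the word for the
    first reflection in type D. *)
Lemma tperm_double_conj a b c d : uniq [:: a; b; c; d] ->
  (tperm b c * tperm a b * tperm c d * tperm b c = tperm a c * tperm b d)%g.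
Proof.
rewrite /= !inE !negb_or -!andbA => /and5P[ab ac ad bc /and3P[bd cd _]].
rewrite -(mulgA (tperm b c)) tperm_conj conjMg !tpermJ tpermL tpermR.
by rewrite !tpermD // eq_sym.
Qed.

End PermutationWords.

(** * The vectors [e k] as differences of reversed coordinates *)

Section ReversedBasis.
Variables (R : realFieldType) (n l : nat) (e : nat -> 'rV[R]_n).
Hypothesis n_bounds : (2 * l <= n <= 2 * l + 1)%N.
Hypothesis eE : forall k (a : 'I_n), (1 <= k <= l)%N -> a = (l - k)%N :> nat ->
  e k = rev_diff R a.
Local Notation span := <<[seq e k | k <- iota 1 l]>>%VS.

Lemma index_proof k : (1 <= k <= l)%N -> (l - k < n)%N.
Proof. by lia. Qed.

Lemma e_rev_diff k (hk : (1 <= k <= l)%N) :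
  e k = rev_diff R (Ordinal (index_proof hk)).
Proof. exact: eE. Qed.

Lemma rev_orth i j : (1 <= i <= l)%N -> (1 <= j <= l)%N ->
  dot (e i) (e j) = (2 * (i == j))%:R.
Proof.
move=> hi hj; rewrite (e_rev_diff hi) (e_rev_diff hj).
set a := Ordinal _; set b := Ordinal _.
rewrite /rev_diff !(dotBl, dotBr) !dot_delta !delta_entry.
rewrite (inj_eq (can_inj rev_ordK)) -!val_eqE /=.
have -> : (l - j == l - i)%N = (i == j) by lia.
have -> : (n - (l - j).+1 == l - i)%N = false by lia.
have -> : (l - j == n - (l - i).+1)%N = false by lia.
by rewrite natrM /=; ring.
Qed.

Lemma rev_odd_e_span x : x \in span -> rev_odd x.
Proof.
apply: rev_odd_span => _ /mapP[k hk ->]; move: hk.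
rewrite mem_iota add1n ltnS => hk; rewrite (e_rev_diff hk).
exact: rev_odd_rev_diff.
Qed.

Lemma mem_e_span k : (1 <= k <= l)%N -> e k \in span.
Proof. by move=> hk; apply/memv_span/map_f; rewrite mem_iota add1n. Qed.

(** An index other than the middle one, or else its reversal, lies among the first [l], so its
    [rev_diff] is some [e k] up to sign. *)
Lemma e_span_faithful (s : 'S_n) :
  {in span, forall x : 'rV_n, x *m perm_mx s = x} -> s = 1%g.
Proof.
move=> fix_s; apply: (@rev_diff_faithful R) => a ra; apply: fix_s.
have := ltn_ord a; have : a <> (n - a.+1)%N :> nat.
  by move=> E; move/eqP: ra; apply; apply: ord_inj; rewrite /= -E.
move=> a_mid a_n; have [a_l|l_a] := ltnP a l.
  rewrite -(eE (k := (l - a)%N)); [apply: mem_e_span; lia | lia | lia].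
have -> : rev_diff R a = - rev_diff R (rev_ord a).
  by rewrite /rev_diff rev_ordK opprB.
rewrite rpredN -(eE (k := (l - rev_ord a)%N)) /=; [apply: mem_e_span| |]; lia.
Qed.

Lemma mul_word_first x (a : 'I_n) : (0 < l)%N -> a.+1 = l :> nat ->
  x \in span -> x *m perm_mx (tperm a (rev_ord a)) = x - cartan x (e 1) *: e 1.
Proof.
move=> l_gt0 al /rev_odd_e_span hx; rewrite (eE (a := a)); try lia.
by apply: mul_rev_tperm => //; rewrite -val_eqE /=; lia.
Qed.

Lemma mul_word_pair x k (a b : 'I_n) : (1 < k <= l)%N ->
  a = (l - k)%N :> nat -> b = a.+1 :> nat -> x \in span ->
  x *m perm_mx (tperm a b * tperm (rev_ord b) (rev_ord a))%g =
    x - cartan x (e k - e k.-1) *: (e k - e k.-1).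
Proof.
move=> hk ak ba /rev_odd_e_span hx.
rewrite (eE (a := a)) ?(eE (k := k.-1) (a := b)); try lia.
by apply: mul_rev_tperm_pair => //=; rewrite !inE -!val_eqE /=; lia.
Qed.

(** Reversing [b] changes the sign of its [rev_diff], so the sum becomes a difference to which the
    formula for a pair of transpositions applies. *)
Lemma mul_word_first_pair x (a b : 'I_n) : (1 < l)%N ->
  a.+2 = l :> nat -> b.+1 = l :> nat -> x \in span ->
  x *m perm_mx (tperm a (rev_ord b) * tperm b (rev_ord a))%g =
    x - cartan x (e 1 + e 2) *: (e 1 + e 2).
Proof.
move=> l2 al bl /rev_odd_e_span hx.
rewrite (eE (a := b)) ?(eE (k := 2) (a := a)); try lia.
have -> : rev_diff R b + rev_diff R a = rev_diff R a - rev_diff R (rev_ord b).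
  by rewrite /rev_diff rev_ordK opprB addrC.
rewrite -{2}[b]rev_ordK.
apply: mul_rev_tperm_pair => //=; rewrite !inE -!val_eqE /=.
by have := ltn_ord b; lia.
Qed.

End ReversedBasis.

Lemma signed_pairsP (R : realFieldType) l n (e : nat -> 'rV[R]_n) b :
  b \in signed_pairs l e <-> pair_root l e b.
Proof.
rewrite /signed_pairs.
split=> [/allpairsPdep[[i j] [[c d] /= [ij cd ->]]]|[i [j [c [d [hi hj ij]]]]]].
  move: ij; rewrite mem_filter => /andP[/= ltij /allpairsPdep[i' [j' [hi hj]]]].
  case=> ei ej; move: hi hj; rewrite -ei -ej !mem_iota !add1n !ltnS => hi hj.
  exists i, j, c, d; rewrite hi hj (ltn_eqF ltij); split=> //.
  by move: cd; rewrite /= !inE => /or4P[]/eqP[-> ->]; rewrite !eqxx ?orbT.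
move=> /andP[sc sd] ->; wlog ltij : i j c d hi hj ij sc sd / (i < j)%N.
  move=> th; have [ltij|leji] := ltnP i j; first exact: th.
  rewrite addrC; apply: th => //; first by rewrite eq_sym.
  by rewrite ltn_neqAle eq_sym ij.
apply/allpairsPdep; exists (i, j), (c, d); split=> //=.
  by rewrite mem_filter /= ltij; apply: allpairs_f; rewrite mem_iota add1n.
by case/signsP: sc => ->; case/signsP: sd => ->; rewrite /= !inE !eqxx ?orbT.
Qed.

Lemma single_rootsP (R : realFieldType) l n (e : nat -> 'rV[R]_n) (m : R) b :
  b \in [seq a *: (m *: e i) | i <- iota 1 l, a <- signs R] <->
  single_root l e [:: m] b.
Proof.
split=> [/allpairsPdep[i [c [hi sc ->]]]|[i [m' [c [hi hm sc ->]]]]].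
  by exists i, m, c; rewrite inE eqxx; move: hi; rewrite mem_iota add1n.
move: hm; rewrite inE => /eqP->.
apply: (@allpairs_f _ _ _ (fun i a => _)) => //.
by rewrite mem_iota add1n.
Qed.

(** * Simple reflections and the diagram symmetry as words in transpositions *)

Section ReversedClassical.
Variables (R : realFieldType) (n l : nat) (Phi : seq 'rV[R]_n).
Variables (e : nat -> 'rV[R]_n) (a1 : 'rV[R]_n) (t : nat) (ms : seq R).
Hypothesis l_gt0 : (0 < l)%N.
Hypothesis n_bounds : (2 * l <= n <= 2 * l + 1)%N.
Hypothesis eE : forall k (a : 'I_n), (1 <= k <= l)%N -> a = (l - k)%N :> nat ->
  e k = rev_diff R a.
Hypothesis PhiE : forall b,
  b \in Phi <-> pair_root l e b \/ single_root l e ms b.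
Hypothesis spec : first_root_spec l e a1 t ms.
Local Notation alpha := (chain_simple e a1).

Let orth := @rev_orth _ _ _ _ n_bounds eE.
Definition rev_classical_base : root_base Phi _ _ :=
  classical_root_base l_gt0 orth PhiE spec.

Lemma rev_classical_span : <<Phi>>%VS = <<[seq e k | k <- iota 1 l]>>%VS.
Proof. exact: span_classical l_gt0 PhiE spec. Qed.

Lemma lin_generated_sub (F : fieldType) (vT : vectType F)
    (S S' : 'End(vT) -> Prop) f :
  (forall g, S g -> S' g) -> lin_generated S f -> lin_generated S' f.
Proof.
move=> SS'; elim=> {f} [|f /SS' Sf|f g _ Sf _ Sg|f _ Sf].
- exact: lin_generated_id.
- exact: lin_generated_in.
- exact: lin_generated_comp.
- exact: lin_generated_inv.
Qed.

Lemma weyl_chain_generated f : weyl Phi f <->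
  lin_generated (fun g => exists2 k, (1 <= k <= l)%N &
    g = reflection Phi (alpha k)) f.
Proof.
rewrite (weyl_simple rev_classical_base f).
split; apply: lin_generated_sub => g.
  by case=> i ->; exists i.+1 => //; rewrite ltn_ord.
by case=> k /range_ordS[i ->] ->; exists i.
Qed.

Lemma restricts_reflection (p : 'S_n) (a : 'rV[R]_n) : a \in <<Phi>>%VS ->
    {in <<[seq e k | k <- iota 1 l]>>%VS, forall x : 'rV_n,
      x *m perm_mx p = x - cartan x a *: a} ->
  perm_restricts p (reflection Phi a).
Proof.
move=> Va pE v; rewrite reflectionE // pE // -rev_classical_span.
exact: subvsP.
Qed.

Lemma alpha_span k : (1 <= k <= l)%N -> alpha k \in <<Phi>>%VS.
Proof. by move/(chain_simple_root l_gt0 PhiE spec)/memv_span. Qed.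

Lemma restricts_first (a : 'I_n) c :
  a.+1 = l :> nat -> c != 0 -> a1 = c *: e 1 ->
  perm_restricts (tperm a (rev_ord a)) (reflection Phi (alpha 1)).
Proof.
move=> al c0 a1E; apply: restricts_reflection; first by rewrite alpha_span.
move=> x /(mul_word_first n_bounds eE l_gt0 al)->.
by rewrite /chain_simple /= a1E cartan_scale.
Qed.

Lemma restricts_pair k (a b : 'I_n) : (1 < k <= l)%N ->
    a = (l - k)%N :> nat -> b = a.+1 :> nat ->
  perm_restricts (tperm a b * tperm (rev_ord b) (rev_ord a))%g
    (reflection Phi (alpha k)).
Proof.
move=> hk al ba; apply: restricts_reflection.
  by rewrite alpha_span //; lia.
move=> x /(mul_word_pair n_bounds eE hk al ba)->.
by rewrite /chain_simple; have -> : (k == 1%N) = false by lia.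
Qed.

Lemma restricts_first_pair (a b : 'I_n) : (1 < l)%N ->
    a.+2 = l :> nat -> b.+1 = l :> nat -> a1 = e 1 + e 2 ->
  perm_restricts (tperm a (rev_ord b) * tperm b (rev_ord a))%g
    (reflection Phi (alpha 1)).
Proof.
move=> l2 al bl a1E; apply: restricts_reflection; first by rewrite alpha_span.
move=> x /(mul_word_first_pair n_bounds eE l2 al bl)->.
by rewrite /chain_simple /= a1E.
Qed.

Lemma rev_span_faithful (s : 'S_n) :
  {in <<Phi>>%VS, forall x : 'rV_n, x *m perm_mx s = x} -> s = 1%g.
Proof. by rewrite rev_classical_span; apply: e_span_faithful. Qed.

Lemma rev_restriction_isom (word : nat -> 'S_n) :
    (forall k, (1 <= k <= l)%N ->
      perm_restricts (word k) (reflection Phi (alpha k))) ->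
  restriction_isom <<[set word i.+1 | i : 'I_l]>>%G (weyl Phi).
Proof.
move=> wordP.
apply: (@weyl_restriction_isom _ _ _ _ _ _ rev_classical_base
  (word \o S \o val)).
  by move=> i; apply: wordP (ordS_range i).
exact: rev_span_faithful.
Qed.

Lemma sA_val (i : nat) (a b : 'I_n) :
  b = a.+1 :> nat -> i = b -> sA n i = tperm a b.
Proof. by move=> ba ->; apply: sA_tperm. Qed.

(** Reversal carries the transposition at [l + 1 - k] to the one at [j], which is [l + k] for
    [n = 2l + 1] and [l - 1 + k] for [n = 2l]. *)
Lemma rev_pair_word k j : (1 < k <= l)%N -> j = (n - l - 1 + k)%N ->
  perm_restricts (sA n (l + 1 - k) * sA n j)%g (reflection Phi (alpha k)) /\
  (sA n (l + 1 - k) * sA n j = sA n j * sA n (l + 1 - k))%g.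
Proof.
move=> hk jE; have lt_a : (l - k < n)%N by lia.
have lt_b : ((l - k).+1 < n)%N by lia.
pose a := Ordinal lt_a; pose b := Ordinal lt_b.
rewrite (@sA_val _ a b) /=; try lia.
rewrite (@sA_val j (rev_ord b) (rev_ord a)) /=; try lia.
split; first by apply: restricts_pair.
by apply: tperm_disjointC; rewrite /= !inE -!val_eqE /=; lia.
Qed.

Lemma rev_middle_index : (l.-1 < n)%N.
Proof. by lia. Qed.

Lemma restricts_first_even c : n = (2 * l)%N -> c != 0 -> a1 = c *: e 1 ->
  perm_restricts (sA n l) (reflection Phi (alpha 1)).
Proof.
move=> nE c0 a1E; pose a := Ordinal rev_middle_index.
rewrite (@sA_val _ a (rev_ord a)) /=; try lia.
by apply: restricts_first c0 a1E => /=; lia.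
Qed.

(** Position [l + 1] is the middle one, and the braid relation turns both words into the
    transposition of its neighbours [l] and [l + 2], exchanged by reversal. *)
Lemma restricts_first_odd c : n = (2 * l + 1)%N -> c != 0 -> a1 = c *: e 1 ->
  perm_restricts (sA n l * sA n (l + 1) * sA n l)%g
    (reflection Phi (alpha 1)) /\
  (sA n l * sA n (l + 1) * sA n l = sA n (l + 1) * sA n l * sA n (l + 1))%g.
Proof.
move=> nE c0 a1E; have lt_m : (l < n)%N by lia.
pose a := Ordinal rev_middle_index; pose m := Ordinal lt_m.
rewrite (@sA_val l a m) /=; try lia.
rewrite (@sA_val (l + 1) m (rev_ord a)) /=; try lia.
have [|||-> ->] := @tperm_braid _ a m (rev_ord a);
  try (rewrite -val_eqE /=; lia).
by split=> //; apply: restricts_first c0 a1E => /=; lia.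
Qed.

Lemma restricts_first_D : n = (2 * l)%N -> (1 < l)%N -> a1 = e 1 + e 2 ->
  perm_restricts (sA n l * sA n (l - 1) * sA n (l + 1) * sA n l)%g
    (reflection Phi (alpha 1)) /\
  (sA n l * sA n (l - 1) * sA n (l + 1) * sA n l =
   sA n l * sA n (l + 1) * sA n (l - 1) * sA n l)%g.
Proof.
move=> nE l2 a1E; have lt_a : (l.-2 < n)%N by lia.
pose a := Ordinal lt_a; pose b := Ordinal rev_middle_index.
rewrite (@sA_val l b (rev_ord b)) /=; try lia.
rewrite (@sA_val (l - 1) a b) /=; try lia.
rewrite (@sA_val (l + 1) (rev_ord b) (rev_ord a)) /=; try lia.
have abU : uniq [:: a; b; rev_ord b; rev_ord a].
  by rewrite /= !inE -!val_eqE /=; lia.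
split.
  rewrite tperm_double_conj //.
  by apply: (restricts_first_pair l2 _ _ a1E) => /=; lia.
by rewrite -!mulgA [(tperm a b * (_ * _))%g]mulgA tperm_disjointC // !mulgA.
Qed.

(** Exchanging the first two simple roots of type D amounts to changing the sign of [e 1], the
    reflection in a vector that is not a root. *)
Lemma chain_swap12 (l2 : (1 < l)%N) (i : 'I_l) : a1 = e 1 + e 2 ->
  alpha (swap12 l2 i).+1 = alpha i.+1 - cartan (alpha i.+1) (e 1) *: e 1.
Proof.
move=> a1E; have cE j : (1 <= j <= l)%N ->
    cartan (e j) (e 1) = 2 * (j == 1%N)%:R.
  by move=> hj; rewrite /cartan !orth // eqxx natrM /=; field.
have c1 : (1 <= 1 <= l)%N by lia.
have c2 : (1 <= 2 <= l)%N by lia.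
have [i0|i0] := eqVneq (i : nat) 0%N.
  have -> : i = Ordinal (ltnW l2) by apply: ord_inj.
  rewrite tpermL /chain_simple /= a1E cartanDl !cE //= mulr1 mulr0 addr0.
  by rewrite scaler_nat mulr2n opprD addrACA subrr add0r.
have [i1|i1] := eqVneq (i : nat) 1%N.
  have -> : i = Ordinal l2 by apply: ord_inj.
  rewrite tpermR /chain_simple /= a1E cartanBl !cE //= mulr1 mulr0 sub0r.
  by rewrite scaleNr opprK scaler_nat mulr2n addrA subrK addrC.
have := ltn_ord i => lt_i; rewrite tpermD; try by rewrite -val_eqE /=; lia.
rewrite /chain_simple eqSS (negbTE i0) cartanBl !cE; try lia.
have -> : (i.+1 == 1%N) = false by lia.
have -> : (i.+1.-1 == 1%N) = false by lia.
by rewrite subrr scale0r subr0.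
Qed.

Lemma swap12_diagram_sym (l2 : (1 < l)%N) : a1 = e 1 + e 2 ->
  swap12 l2 \in diagram_sym (fun i : 'I_l => alpha i.+1).
Proof.
move=> a1E; rewrite inE; apply/forallP=> i; apply/forallP=> j.
have dotE x y : dot (x - cartan x (e 1) *: e 1) (y - cartan y (e 1) *: e 1) =
    dot x y.
  have e1 : dot (e 1) (e 1) = 2 by rewrite orth //; lia.
  rewrite /cartan !(dotBl, dotBr, dotZl, dotZr) e1 (dotC (e 1) y).
  by field.
by rewrite !chain_swap12 // -[X in X == _]/(2 * dot _ _ / dot _ _) !dotE.
Qed.

(** The transposition of the two middle coordinates acts on the span as the reflection in [e 1]. The
    maps are compared inside the ambient space, so that preservation of the span is part of the
    conclusion. *)
Lemma restricts_swap12 (l2 : (1 < l)%N) : n = (2 * l)%N -> a1 = e 1 + e 2 ->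
  perm_restricts (sA n l) (diagram_aut rev_classical_base (swap12 l2)).
Proof.
move=> nE a1E; pose a := Ordinal rev_middle_index.
rewrite (@sA_val _ a (rev_ord a)) /=; try lia.
pose f : {linear subvs_of <<Phi>>%VS -> 'rV[R]_n} :=
  mulmxr (perm_mx (tperm a (rev_ord a))) \o vsval.
pose g : {linear subvs_of <<Phi>>%VS -> 'rV[R]_n} :=
  vsval \o diagram_aut rev_classical_base (swap12 l2).
apply: (@eq_on_simple _ _ _ _ _ _ rev_classical_base _ f g) => i.
have Vi := alpha_span (ordS_range i).
have Vsi := alpha_span (ordS_range (swap12 l2 i)).
rewrite /= diagram_autE !vsprojK // chain_swap12 //.
apply: (mul_word_first n_bounds eE l_gt0) => /=; first lia.
by rewrite -rev_classical_span.
Qed.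

Lemma diagram_sym_group_D (l2 : (1 < l)%N) :
  t = 0 -> a1 = e 1 + e 2 -> l != 4 ->
  diagram_sym_group (fun i : 'I_l => alpha i.+1) = <[swap12 l2]>%G.
Proof.
move=> t0 a1E l4; apply/group_inj/eqP; rewrite eqEsubset cycle_subG /=.
rewrite swap12_diagram_sym // andbT; apply/subsetP=> s Ds.
by have [->|->] := diagram_sym_D l_gt0 orth PhiE spec l2 t0 l4 Ds;
  [apply: group1 | apply: cycle_id].
Qed.

End ReversedClassical.

Lemma cycle_swap12_isog l (l2 : (1 < l)%N) : <[swap12 l2]> \isog [set: 'Z_2].
Proof.
have o2 : #[swap12 l2]%g = 2.
  apply: nt_prime_order => //; first by rewrite expgS expg1 tperm2.
  apply/eqP=> /permP/(_ (Ordinal l2)); rewrite perm1 tpermR.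
  by move/(congr1 val).
by rewrite isog_sym; have := Zp_isog (swap12 l2); rewrite o2.
Qed.

(** * The realizations of types B, C and D *)

Section Realizations.
Variables (R : realFieldType) (l : nat).

Lemma eps_rev_diff n p q (a : 'I_n) :
  p = a.+1 -> q = (n - a)%N -> eps R n p - eps R n q = rev_diff R a.
Proof.
move=> -> ->; have -> : (n - a)%N = (rev_ord a).+1.
  by rewrite /= -subSn // subSS.
by rewrite !eps_delta.
Qed.

Lemma epsB_rev_diff k (a : 'I_(2 * l + 1)) : (1 <= k <= l)%N ->
  a = (l - k)%N :> nat -> epsB R l k = rev_diff R a.
Proof. by move=> hk ak; apply: eps_rev_diff; lia. Qed.

Lemma epsC_rev_diff k (a : 'I_(2 * l)) : (1 <= k <= l)%N ->
  a = (l - k)%N :> nat -> epsC R l k = rev_diff R a.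
Proof. by move=> hk ak; apply: eps_rev_diff; lia. Qed.

Lemma PhiBE b : b \in PhiB R l <->
  pair_root l (epsB R l) b \/ single_root l (epsB R l) [:: 1] b.
Proof.
(* The factor 1 gives type B the same shape as type C, where the factor is 2. *)
have -> : PhiB R l = signed_pairs l (epsB R l) ++
    [seq a *: (1 *: epsB R l i) | i <- iota 1 l, a <- signs R].
  by congr (_ ++ _); apply: eq_allpairs => i c; rewrite scale1r.
by rewrite -single_rootsP -signed_pairsP mem_cat; split=> /orP.
Qed.

Lemma PhiCE b : b \in PhiC R l <->
  pair_root l (epsC R l) b \/ single_root l (epsC R l) [:: 2] b.
Proof. by rewrite -single_rootsP -signed_pairsP mem_cat; split=> /orP. Qed.

Lemma PhiDE b : b \in PhiD R l <->
  pair_root l (epsD R l) b \/ single_root l (epsD R l) [::] b.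
Proof.
by rewrite signed_pairsP; split=> [|[//|[i [m [c []]]]]]; first by left.
Qed.

Lemma specB : first_root_spec l (epsB R l) (epsB R l 1) 2 [:: 1].
Proof. by constructor 1. Qed.

Lemma specC : first_root_spec l (epsC R l) (2 *: epsC R l 1) 1 [:: 2].
Proof. by constructor 2. Qed.

Lemma specD : (1 < l)%N ->
  first_root_spec l (epsD R l) (epsD R l 1 + epsD R l 2) 0 [::].
Proof. by constructor 3. Qed.

End Realizations.

Theorem proposition5p1 (R : realFieldType) (l : nat) :
  (* type B *)
  ((1 <= l)%N ->
   let Phi := PhiB R l in
   let s := sA (2 * l + 1) in
   let sB k := reflection Phi (alphaB R l k) in
   [/\ <<Phi>>%VS = <<[seq epsB R l k | k <- iota 1 l]>>%VS,
       (forall f, root_aut Phi f <-> weyl Phi f)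
       /\ (forall f, weyl Phi f <->
             lin_generated (fun g => exists2 k, (1 <= k <= l)%N & g = sB k) f),
       perm_restricts (s l * s (l + 1)%N * s l)%g (sB 1%N)
       /\ (s l * s (l + 1)%N * s l = s (l + 1)%N * s l * s (l + 1)%N)%g,
       forall k, (1 < k <= l)%N ->
         perm_restricts (s (l + 1 - k)%N * s (l + k)%N)%g (sB k)
         /\ (s (l + 1 - k)%N * s (l + k)%N = s (l + k)%N * s (l + 1 - k)%N)%g
     & restriction_isom <<[set wordB l i.+1 | i : 'I_l]>>%G (weyl Phi)])
  /\
  (* type C *)
  ((1 <= l)%N ->
   let Phi := PhiC R l in
   let s := sA (2 * l) in
   let sC k := reflection Phi (alphaC R l k) in
   [/\ <<Phi>>%VS = <<[seq epsC R l k | k <- iota 1 l]>>%VS,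
       (forall f, root_aut Phi f <-> weyl Phi f)
       /\ (forall f, weyl Phi f <->
             lin_generated (fun g => exists2 k, (1 <= k <= l)%N & g = sC k) f),
       perm_restricts (s l) (sC 1%N),
       forall k, (1 < k <= l)%N ->
         perm_restricts (s (l + 1 - k)%N * s (l - 1 + k)%N)%g (sC k)
         /\ (s (l + 1 - k)%N * s (l - 1 + k)%N
               = s (l - 1 + k)%N * s (l + 1 - k)%N)%g
     & restriction_isom <<[set wordC l i.+1 | i : 'I_l]>>%G (weyl Phi)])
  /\
  (* type D *)
  (forall lt1l : (1 < l)%N,
   let Phi := PhiD R l in
   let s := sA (2 * l) in
   let sD k := reflection Phi (alphaD R l k) in
   let tau := swap12 lt1l in
   <<Phi>>%VS = <<[seq epsD R l k | k <- iota 1 l]>>%VS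
   /\
   (forall f, weyl Phi f <->
      lin_generated (fun g => exists2 k, (1 <= k <= l)%N & g = sD k) f)
   /\
   (exists phi : 'S_l -> 'End(subvs_of <<Phi>>%VS),
      [/\ {in OutD R l, forall t,
             diagram_extends (fun i : 'I_l => alphaD R l i.+1) t (phi t)},
          lin_sdprod (root_aut Phi) (weyl Phi) (OutD R l) phi
        & perm_restricts (s l) (phi tau)])
   /\
   tau \in OutD R l
   /\
   (* the diagram D_4 has further symmetries *)
   (l != 4%N -> OutD R l = <[tau]>%G /\ OutD R l \isog [set: 'Z_2])
   /\
   (perm_restricts (s l * s (l - 1)%N * s (l + 1)%N * s l)%g (sD 1%N)
    /\ (s l * s (l - 1)%N * s (l + 1)%N * s l
          = s l * s (l + 1)%N * s (l - 1)%N * s l)%g)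
   /\
   (forall k, (1 < k <= l)%N ->
      perm_restricts (s (l + 1 - k)%N * s (l - 1 + k)%N)%g (sD k)
      /\ (s (l + 1 - k)%N * s (l - 1 + k)%N
            = s (l - 1 + k)%N * s (l + 1 - k)%N)%g)
   /\
   restriction_isom <<[set wordD l i.+1 | i : 'I_l]>>%G (weyl Phi)).
Proof.
have nB : (2 * l <= 2 * l + 1 <= 2 * l + 1)%N by lia.
have nC : (2 * l <= 2 * l <= 2 * l + 1)%N by lia.
have n1 : (1 : R) != 0 by rewrite oner_eq0.
have n2 : (2 : R) != 0 by rewrite pnatr_eq0.
have eB := @epsB_rev_diff R l; have eC := @epsC_rev_diff R l.
have PB := @PhiBE R l; have PC := @PhiCE R l; have PD := @PhiDE R l.
have sB := specB R l; have sC := specC R l; have sD := @specD R l.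
have aB : epsB R l 1 = 1 *: epsB R l 1 by rewrite scale1r.
split; [move=> l_gt0 Phi s sB' | split; [move=> l_gt0 Phi s sC' |]].
- have base := rev_classical_base l_gt0 nB eB PB sB.
  have [first braid] := restricts_first_odd l_gt0 nB eB PB sB erefl n1 aB.
  have pairB k : (1 < k <= l)%N ->
      perm_restricts (s (l + 1 - k)%N * s (l + k)%N)%g (sB' k) /\
      (s (l + 1 - k)%N * s (l + k)%N = s (l + k)%N * s (l + 1 - k)%N)%g.
    by move=> hk; apply: (rev_pair_word l_gt0 nB eB PB sB hk); lia.
  split=> //; first exact: rev_classical_span l_gt0 PB sB.
    split=> f; last exact: weyl_chain_generated l_gt0 nB eB PB sB f.
    apply: root_aut_weyl base _ f.
    exact: diagram_sym_trivial l_gt0 (@rev_orth _ _ _ _ nB eB) PB sB isT.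
  apply: (rev_restriction_isom l_gt0 nB eB PB sB) => k hk; rewrite /wordB.
  have [->|k1] := eqVneq k 1%N; first exact: first.
  by apply: (pairB k _).1; lia.
- have base := rev_classical_base l_gt0 nC eC PC sC.
  have first := restricts_first_even l_gt0 nC eC PC sC erefl n2 erefl.
  have pairC k : (1 < k <= l)%N ->
      perm_restricts (s (l + 1 - k)%N * s (l - 1 + k)%N)%g (sC' k) /\
      (s (l + 1 - k)%N * s (l - 1 + k)%N =
       s (l - 1 + k)%N * s (l + 1 - k)%N)%g.
    by move=> hk; apply: (rev_pair_word l_gt0 nC eC PC sC hk); lia.
  split=> //; first exact: rev_classical_span l_gt0 PC sC.
    split=> f; last exact: weyl_chain_generated l_gt0 nC eC PC sC f.
    apply: root_aut_weyl base _ f.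
    exact: diagram_sym_trivial l_gt0 (@rev_orth _ _ _ _ nC eC) PC sC isT.
  apply: (rev_restriction_isom l_gt0 nC eC PC sC) => k hk; rewrite /wordC.
  have [->|k1] := eqVneq k 1%N; first exact: first.
  by apply: (pairC k _).1; lia.
move=> l2 Phi s sD' tau; have l_gt0 := ltnW l2; have {}sD := sD l2.
have base := rev_classical_base l_gt0 nC eC PD sD.
have firstD := restricts_first_D l_gt0 nC eC PD sD erefl l2 erefl.
have pairD k : (1 < k <= l)%N ->
    perm_restricts (s (l + 1 - k)%N * s (l - 1 + k)%N)%g (sD' k) /\
    (s (l + 1 - k)%N * s (l - 1 + k)%N =
     s (l - 1 + k)%N * s (l + 1 - k)%N)%g.
  by move=> hk; apply: (rev_pair_word l_gt0 nC eC PD sD hk); lia.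
split; first exact: rev_classical_span l_gt0 PD sD.
split; first exact: weyl_chain_generated l_gt0 nC eC PD sD.
split.
  exists (diagram_aut (rev_classical_base l_gt0 nC eC PD sD)); split.
  - by move=> t _; apply: diagram_aut_extends.
  - exact: root_aut_sdprod.
  - exact: restricts_swap12.
split; first exact: swap12_diagram_sym l_gt0 nC eC l2 erefl.
split.
  move=> l4.
  have outE : OutD R l = <[tau]>%G.
    exact: diagram_sym_group_D l_gt0 nC eC PD sD l2 erefl erefl l4.
  by split=> //; rewrite outE; apply: cycle_swap12_isog.
split=> //; split=> //.
apply: (rev_restriction_isom l_gt0 nC eC PD sD) => k hk; rewrite /wordD.
have [->|k1] := eqVneq k 1%N; first exact: firstD.1.
by apply: (pairD k _).1; lia.
Qed.
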